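(* For every integer $n\geq 0$, \begin{align*} ped(225n+43) &\equiv 0 \pmod{192},\\ ped(225n+88) &\equiv 0 \pmod{192},\\ ped(225n+133) &\equiv 0 \pmod{192},\\ ped(225n+223) &\equiv 0 \pmod{192}. \end{align*}
   Context: For an integer $n\ge 0$, $ped(n)$ denotes the number of partitions of $n$ in which the even parts are distinct and the odd parts are unrestricted, with $ped(0)=1$. Equivalently, $$\sum_{n=0}^{\infty} ped(n)q^n = \prod_{m=1}^{\infty}\frac{1-q^{4m}}{1-q^{m}}.$$ *)

(* Defs.v *)
From HB Require Import structures.
From mathcomp Require Import all_boot.

Set Implicit Arguments.
Unset Strict Implicit.
Unset Printing Implicit Defensive.

(* A partition of n is a non-increasing sequence of positive integers with
   sum n; the empty sequence is the only partition of 0. *)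
Definition is_partition (n : nat) (s : seq nat) : bool :=
  [&& sorted geq s, 0 \notin s & sumn s == n].

Definition is_ped_partition (n : nat) (s : seq nat) : bool :=
  is_partition n s && uniq [seq x <- s | ~~ odd x].

(* n.-bseq 'I_n.+1 is the finite type of sequences of length at most n with
   entries at most n; by is_partition_bounds below it misses no partition. *)
Definition ped (n : nat) : nat :=
  #|[set s : n.-bseq 'I_n.+1 | is_ped_partition n [seq val i | i <- s]]|.

Lemma is_partition_bounds (n : nat) (s : seq nat) :
  is_partition n s -> (size s <= n) && all (leq^~ n) s.
Proof.
case/and3P=> _ s0 /eqP <-; apply/andP; split.
  elim: s s0 => //= x s IHs; rewrite inE negb_or eq_sym -lt0n.
  by case/andP=> x0 /IHs le_s; rewrite -add1n leq_add.
apply/allP=> x; elim: s {s0} => //= y s IHs; rewrite inE.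
case/predU1P=> [->|/IHs le_x]; first exact: leq_addr.
exact: leq_trans le_x (leq_addl _ _).
Qed.

(* Main.v *)
(* Put
     phi = sum_(n in Z) q^(n^2),  psi = sum_(n >= 0) q^(n(n+1)/2),
     P = sum_(n in Z) q^(n(3n+1)/2),  Omega = sum_(n in Z) q^(3n^2+2n).
   After q -> -q the generating function of ped is psi / phi.  Dissecting twice
   modulo 3, the series of the (-1)^n ped(9n+7) equals
     12 F(q) phi(q)^2 phi(q^3)^4 / phi(q)^8,  with F(q) = P(q) psi(q^6),
   and phi^8 = 1 mod 16.  Since F is an eta quotient, its logarithmic
   derivative can be compared modulo 4 with (phi^2 - 1)/4, which gives
     F phi(q)^2 phi(q^3)^4 = F + 4 q F' mod 16;
   hence ped(9n+7) vanishes modulo 192 whenever the n-th coefficient of F does.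
   This coefficient is nonzero only if 24n + 19 = x^2 + 18 v^2, and as -2 is not
   a square modulo 5, 24n + 19 cannot then be divisible by 5 but not by 25. *)

Require Import Defs.
From HB Require Import structures.
From mathcomp Require Import all_boot all_order all_algebra.
From mathcomp Require Import boolp zify ring.

Set Implicit Arguments.
Unset Strict Implicit.
Unset Printing Implicit Defensive.

Import Order.TTheory GRing.Theory Num.Theory.
Local Open Scope ring_scope.

(** * Formal power series with integer coefficients *)

(** Dissecting a quotient by [phi] requires a denominator that is a series in X^3. The conjugates of
    [phi] under X -> wX, with w a cube root of unity, supply it; as no square is 2 modulo 3, [phi]
    has only two components, and both its norm and the product of the other two conjugates are short
    explicit expressions. All of this takes place over the integers and without quotients:
    identities between eta quotients have their denominators cleared, and are proved by cancelling a
    series with nonzero constant term. In 192 = 12 * 16, the factor 12 = 3 * 2^2 is a coefficient of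
    the squared conjugate product, and 16 is the modulus 4 of the logarithmic derivatives times the
    4 in phi^2 = 1 + 4 (...). The correction 4 q F' does no harm because q d/dq multiplies the n-th
    coefficient by n and so creates no new exponent. *)

Record fps := Fps { coefs :> nat -> int }.

HB.instance Definition _ := gen_eqMixin fps.
HB.instance Definition _ := gen_choiceMixin fps.

Lemma fpsP (a b : fps) : (forall n, a n = b n) -> a = b.
Proof. by case: a b => [a] [b] /= /funext ->. Qed.

Definition fps_add (a b : fps) := Fps (fun n => a n + b n).
Definition fps_opp (a : fps) := Fps (fun n => - a n).
Definition fps_mul (a b : fps) :=
  Fps (fun n => \sum_(i < n.+1) a i * b (n - i)%N).
Definition fps_of_poly (p : {poly int}) := Fps (fun n => p`_n).
Definition trunc (N : nat) (a : fps) : {poly int} := \poly_(i < N) a i.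

Lemma coef_trunc N (a : fps) n : (n < N)%N -> (trunc N a)`_n = a n.
Proof. by move=> ltnN; rewrite coef_poly ltnN. Qed.

Lemma fps_mulE N (a b : fps) n :
  (n < N)%N -> fps_mul a b n = (trunc N a * trunc N b)`_n.
Proof.
move=> ltnN; rewrite coefM; apply: eq_bigr => i _.
by have ltin := ltn_ord i; rewrite !coef_trunc //; lia.
Qed.

Lemma fps_addA : associative fps_add.
Proof. by move=> a b c; apply: fpsP => n /=; rewrite addrA. Qed.

Lemma fps_addC : commutative fps_add.
Proof. by move=> a b; apply: fpsP => n /=; rewrite addrC. Qed.

Lemma fps_add0 : left_id (fps_of_poly 0) fps_add.
Proof. by move=> a; apply: fpsP => n /=; rewrite coef0 add0r. Qed.

Lemma fps_addN : left_inverse (fps_of_poly 0) fps_opp fps_add.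
Proof. by move=> a; apply: fpsP => n /=; rewrite coef0 addNr. Qed.

HB.instance Definition _ :=
  GRing.isZmodule.Build fps fps_addA fps_addC fps_add0 fps_addN.

Lemma coef_eq_mul (p q r s : {poly int}) n :
  (forall i, (i <= n)%N -> p`_i = q`_i) ->
  (forall i, (i <= n)%N -> r`_i = s`_i) -> (p * r)`_n = (q * s)`_n.
Proof.
move=> pq rs; rewrite !coefM; apply: eq_bigr => i _.
by have ltin := ltn_ord i; rewrite pq ?rs //; lia.
Qed.

Lemma fps_mulC : commutative fps_mul.
Proof.
by move=> a b; apply: fpsP => n; rewrite !(@fps_mulE n.+1) // mulrC.
Qed.

Lemma fps_mulA : associative fps_mul.
Proof.
move=> a b c; apply: fpsP => n; rewrite !(@fps_mulE n.+1) //.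
transitivity (trunc n.+1 a * trunc n.+1 b * trunc n.+1 c)`_n.
  rewrite -mulrA; apply: coef_eq_mul => // i lein.
  by rewrite coef_trunc // (@fps_mulE n.+1).
apply: coef_eq_mul => // i lein.
by rewrite coef_trunc // (@fps_mulE n.+1).
Qed.

Lemma fps_mul1 : left_id (fps_of_poly 1) fps_mul.
Proof.
move=> a; apply: fpsP => n; rewrite (@fps_mulE n.+1) //.
rewrite -[RHS](@coef_trunc n.+1) // -[in RHS](mul1r (trunc _ a)).
by apply: coef_eq_mul => // i lein; rewrite coef_trunc.
Qed.

Lemma fps_mulDl : left_distributive fps_mul fps_add.
Proof.
move=> a b c; apply: fpsP => n /=; rewrite -big_split.
by apply: eq_bigr => i _; rewrite mulrDl.
Qed.

Lemma fps_1neq0 : fps_of_poly 1 != 0.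
Proof.
by apply/eqP => /(congr1 (fun a : fps => a 0%N)) /=; rewrite coef1 coef0.
Qed.

HB.instance Definition _ := GRing.Zmodule_isComNzRing.Build fps
  fps_mulA fps_mulC fps_mul1 fps_mulDl fps_1neq0.

Lemma fpsM N (a b : fps) n :
  (n < N)%N -> (a * b) n = (trunc N a * trunc N b)`_n.
Proof. exact: fps_mulE. Qed.

Lemma fps_sumM (a b : fps) n : (a * b) n = \sum_(i < n.+1) a i * b (n - i)%N.
Proof. by []. Qed.

Lemma fpsD (a b : fps) n : (a + b) n = a n + b n. Proof. by []. Qed.
Lemma fpsN (a : fps) n : (- a) n = - a n. Proof. by []. Qed.
Lemma fpsB (a b : fps) n : (a - b) n = a n - b n. Proof. by []. Qed.

Lemma fps_0 n : (0 : fps) n = 0. Proof. exact: coef0. Qed.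
Lemma fps_1 n : (1 : fps) n = (n == 0%N)%:R. Proof. exact: coef1. Qed.

Lemma fps_mulrn (a : fps) k n : (a *+ k) n = a n *+ k.
Proof. by elim: k => [|k IHk]; rewrite ?mulr0n ?fps_0 // !mulrS fpsD IHk. Qed.

Lemma fps_M0 (a b : fps) : (a * b) 0%N = a 0%N * b 0%N.
Proof. by rewrite fps_sumM big_ord_recl big_ord0 addr0. Qed.

Lemma fps_X0 (a : fps) k : (a ^+ k) 0%N = a 0%N ^+ k.
Proof. by elim: k => [|k IHk]; rewrite ?expr0 ?fps_1 // !exprS fps_M0 IHk. Qed.

Lemma fps_sum I r (P : pred I) (F : I -> fps) n :
  (\sum_(i <- r | P i) F i) n = \sum_(i <- r | P i) F i n.
Proof.
elim/big_rec2: _ => [|i x y _ <-]; [exact: fps_0 | exact: fpsD].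
Qed.

Lemma fps_of_poly_is_zmod_morphism : zmod_morphism fps_of_poly.
Proof. by move=> p q; apply: fpsP => n; rewrite /= coefB. Qed.

Lemma fps_of_poly_is_monoid_morphism : monoid_morphism fps_of_poly.
Proof.
split=> // p q; apply: fpsP => n; rewrite (@fpsM n.+1) //.
by apply: coef_eq_mul => i lein; rewrite coef_trunc.
Qed.

HB.instance Definition _ := GRing.isZmodMorphism.Build
  {poly int} fps fps_of_poly fps_of_poly_is_zmod_morphism.
HB.instance Definition _ := GRing.isMonoidMorphism.Build
  {poly int} fps fps_of_poly fps_of_poly_is_monoid_morphism.

Definition X : fps := fps_of_poly 'X.

Lemma fps_Xn k : X ^+ k = fps_of_poly 'X^k.
Proof. by rewrite rmorphXn. Qed.

Lemma coef_Xn k n : (X ^+ k) n = (n == k)%:R.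
Proof. by rewrite fps_Xn /= coefXn. Qed.

Lemma coef_XnM k (a : fps) n :
  (X ^+ k * a) n = if (n < k)%N then 0 else a (n - k)%N.
Proof.
rewrite (@fpsM n.+1) // fps_Xn.
rewrite (@coef_eq_mul _ 'X^k _ (trunc n.+1 a) n) ?coefXnM //.
  by case: ifP => // _; rewrite coef_trunc //; lia.
by move=> i lein; rewrite coef_trunc.
Qed.

(** * Agreement of coefficients below N, cancellation and inversion *)

Definition eqmod (N : nat) (a b : fps) := forall n, (n < N)%N -> a n = b n.

Lemma eqmod_refl N a : eqmod N a a. Proof. by []. Qed.
Lemma eqmod_sym N a b : eqmod N a b -> eqmod N b a.
Proof. by move=> ab n /ab. Qed.
Lemma eqmod_trans N b a c : eqmod N a b -> eqmod N b c -> eqmod N a c.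
Proof. by move=> ab bc n ltnN; rewrite ab ?bc. Qed.

Lemma eqmod_le M N a b : (M <= N)%N -> eqmod N a b -> eqmod M a b.
Proof. by move=> leMN ab n ltnM; apply/ab/(leq_trans ltnM). Qed.

Lemma eqmodP a b : (forall N, eqmod N a b) -> a = b.
Proof. by move=> ab; apply: fpsP => n; apply: (ab n.+1). Qed.

Lemma eqmodD N a b c d : eqmod N a b -> eqmod N c d -> eqmod N (a + c) (b + d).
Proof. by move=> ab cd n ltnN; rewrite !fpsD ab ?cd. Qed.

Lemma eqmodM N a b c d : eqmod N a b -> eqmod N c d -> eqmod N (a * c) (b * d).
Proof.
move=> ab cd n ltnN; rewrite !fps_sumM; apply: eq_bigr => i _.
by have ltin := ltn_ord i; rewrite ab ?cd //; lia.
Qed.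

Lemma eqmod_sum N (I : Type) (r : seq I) (P : pred I) (F G : I -> fps) :
  (forall i, P i -> eqmod N (F i) (G i)) ->
  eqmod N (\sum_(i <- r | P i) F i) (\sum_(i <- r | P i) G i).
Proof.
by move=> FG n ltnN; rewrite !fps_sum; apply: eq_bigr => i /FG ->.
Qed.

Lemma eqmod_prod1 N (I : Type) (r : seq I) (P : pred I) (F : I -> fps) :
  (forall i, P i -> eqmod N (F i) 1) -> eqmod N (\prod_(i <- r | P i) F i) 1.
Proof.
move=> F1; elim/big_ind: _ => // a b a1 b1.
by rewrite -[1](mulr1 1); apply: eqmodM.
Qed.

Lemma eqmod_XnM N k a b :
  eqmod (N - k) a b -> eqmod N (X ^+ k * a) (X ^+ k * b).
Proof.
by move=> ab n ltnN; rewrite !coef_XnM; case: ifP => // ?; apply: ab; lia.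
Qed.

Lemma eqmod_Xn0 N k a : (N <= k)%N -> eqmod N (X ^+ k * a) 0.
Proof. by move=> leNk n ltnN; rewrite coef_XnM fps_0 ifT //; lia. Qed.

Lemma fps_mulI (u a b : fps) : u 0%N != 0 -> u * a = u * b -> a = b.
Proof.
move=> u0 /eqP; rewrite -subr_eq0 -mulrBr => /eqP uab.
apply/eqP; rewrite -subr_eq0; apply/eqP; move: (a - b) uab => {a b} a ua0.
apply: fpsP => n; rewrite fps_0; elim/ltn_ind: n => n IHn.
have := congr1 (fun c : fps => c n) ua0; rewrite fps_0 fps_sumM.
rewrite big_ord_recl subn0 big1 ?addr0 => [|i _].
  by move/eqP; rewrite mulf_eq0 (negPf u0) => /eqP.
by rewrite IHn ?mulr0 // lift0; case: i => i /= ?; lia.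
Qed.

Lemma fps_XnI k (a b : fps) : X ^+ k * a = X ^+ k * b -> a = b.
Proof.
move=> ab; apply: fpsP => n; have := congr1 (fun c : fps => c (k + n)%N) ab.
by rewrite !coef_XnM ltnNge leq_addr /= addKn.
Qed.

Lemma fps_natI k (a b : fps) : (0 < k)%N -> k%:R * a = k%:R * b -> a = b.
Proof.
move=> k0; rewrite !mulr_natl => ab; apply: fpsP => n.
have := congr1 (fun c : fps => c n) ab; rewrite !fps_mulrn => /eqP.
by rewrite eqrMn2r -?lt0n => // /orP[/eqP|/eqP //]; lia.
Qed.

Lemma eqmod_expr (w : fps) k : w 0%N = 0 -> eqmod k (w ^+ k) 0.
Proof.
move=> w0; elim: k => [//|k IHk] n; rewrite ltnS => lenk.
rewrite exprS fps_sumM big1 ?fps_0 // => -[[|i] /= lti] _.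
  by rewrite w0 mul0r.
by rewrite IHk ?fps_0 ?mulr0 //; lia.
Qed.

Lemma fps_inv (u : fps) : u 0%N = 1 -> exists v, u * v = 1.
Proof.
move=> u0; pose w : fps := 1 - u.
have w0 : w 0%N = 0 by rewrite /w fpsB fps_1 u0 subrr.
pose s N : fps := \sum_(i < N) w ^+ i.
have us N : u * s N = 1 - w ^+ N.
  by rewrite -(expr1n _ N) subrXX; congr (_ * _);
    [rewrite /w; ring | apply: eq_bigr => i _; rewrite expr1n mul1r].
have sE N n : (n < N)%N -> s N n = s n.+1 n.
  move=> ltnN; rewrite /s -!(big_mkord xpredT (fun i => w ^+ i)).
  rewrite (big_cat_nat (n := n.+1)) //= [X in _ + X]fps_sum.
  rewrite [X in _ + X]big_nat_cond [X in _ + X]big1 ?addr0 // =>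
    i /andP[/andP[ltni _] _].
  by rewrite (@eqmod_expr w i w0) ?fps_0.
(* The powers [w ^+ i] with i > n vanish at n, so coefficient n of the geometric series is read off
   its first n+1 terms. *)
exists (Fps (fun n => s n.+1 n)); apply: eqmodP => N.
apply: (@eqmod_trans _ (u * s N)).
  by apply: eqmodM => // n ltnN; rewrite sE.
by rewrite us => n ltnN; rewrite fpsB (@eqmod_expr w N w0) // fps_0 subr0.
Qed.

(** * Substitutions, derivation and 3-dissection *)

(** The substitution X -> X^k. For k = 0 the formula keeps the constant term, which is still a ring
    morphism, so the instances below hold for every k. *)
Definition V (k : nat) (a : fps) :=
  Fps (fun n => if (k %| n)%N then a (n %/ k)%N else 0).

Lemma coef_V k (a : fps) n : (0 < k)%N -> V k a (k * n)%N = a n.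
Proof. by move=> k0; rewrite /= dvdn_mulr // mulKn. Qed.

Lemma V_0 k (a : fps) : V k a 0%N = a 0%N.
Proof. by rewrite /= dvdn0 div0n. Qed.

Lemma V_is_zmod_morphism k : zmod_morphism (V k).
Proof.
by move=> a b; apply: fpsP => n; rewrite fpsB /=; case: ifP; rewrite ?subr0.
Qed.

Lemma V_is_monoid_morphism k : monoid_morphism (V k).
Proof.
split=> [|a b]; apply: fpsP => n.
  rewrite fps_1 /= coef1; case: (posnP n) => [->|n0];
    first by rewrite dvdn0 div0n.
  case: ifP => // /dvdnP[m nE]; move: n0; rewrite nE muln_gt0 => /andP[m0 k0].
  by rewrite mulnK // (gtn_eqF m0).
have [->|k0] := posnP k.
  case: n => [|n]; first by rewrite fps_M0 !V_0 fps_M0.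
  rewrite fps_sumM /= big1 // => -[[|i] lti] _ /=; last by rewrite mul0r.
  by rewrite mulr0.
have VE (c : fps) i : (i <= n)%N ->
    (trunc n.+1 (V k c))`_i = (trunc n.+1 c \Po 'X^k)`_i.
  move=> lein; rewrite coef_trunc // coef_comp_poly_Xn //=.
  by case: ifP => // _; rewrite coef_trunc // ltnS (leq_trans _ lein) // leq_div.
rewrite (@fpsM n.+1) // (coef_eq_mul (VE a) (VE b)).
rewrite -comp_polyM coef_comp_poly_Xn //.
rewrite -[LHS]/(if (k %| n)%N then (a * b) (n %/ k)%N else 0);
  case: ifP => // _.
by rewrite (@fpsM n.+1) // ltnS leq_div.
Qed.

HB.instance Definition _ k :=
  GRing.isZmodMorphism.Build fps fps (V k) (V_is_zmod_morphism k).
HB.instance Definition _ k :=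
  GRing.isMonoidMorphism.Build fps fps (V k) (V_is_monoid_morphism k).

Lemma V_V k l a : (0 < k)%N -> V k (V l a) = V (k * l) a.
Proof.
move=> k0; apply: fpsP => n /=; case: (boolP (k %| n)%N) => [/dvdnP[m ->]|ndvd].
  by rewrite mulnK // [(m * k)%N]mulnC dvdn_pmul2l // divnMl.
by case: ifP => // /(dvdn_trans (dvdn_mulr l (dvdnn k))); rewrite (negPf ndvd).
Qed.

Lemma V_X k : (0 < k)%N -> V k X = X ^+ k.
Proof.
move=> k0; apply: fpsP => n; rewrite coef_Xn /= coefX.
case: ifP => [/dvdnP[m ->]|ndvd]; last by case: eqP ndvd => // ->;
  rewrite dvdnn.
by rewrite mulnK // -{2}[k]mul1n eqn_pmul2r.
Qed.

Lemma V_eqmod k N a b : (0 < k)%N -> eqmod N a b -> eqmod N (V k a) (V k b).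
Proof.
move=> k0 ab n ltnN /=; case: ifP => // _; apply: ab.
exact: leq_ltn_trans (leq_div _ _) ltnN.
Qed.

Definition alt (a : fps) := Fps (fun n => (-1) ^+ n * a n).

Lemma coef_alt a n : alt a n = (-1) ^+ n * a n. Proof. by []. Qed.

Lemma alt_is_zmod_morphism : zmod_morphism alt.
Proof. by move=> a b; apply: fpsP => n; rewrite fpsB !coef_alt mulrBr. Qed.

Lemma alt_is_monoid_morphism : monoid_morphism alt.
Proof.
split=> [|a b]; apply: fpsP => n.
  by rewrite coef_alt fps_1; case: n => [|n]; rewrite ?mulr1 ?mulr0.
rewrite coef_alt !fps_sumM mulr_sumr; apply: eq_bigr => i _.
have lein : (i <= n)%N by rewrite -ltnS.
by rewrite !coef_alt -{1}(subnKC lein) exprD; ring.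
Qed.

HB.instance Definition _ :=
  GRing.isZmodMorphism.Build fps fps alt alt_is_zmod_morphism.
HB.instance Definition _ :=
  GRing.isMonoidMorphism.Build fps fps alt alt_is_monoid_morphism.

Lemma alt_X : alt X = - X.
Proof.
apply: fpsP => n; rewrite fpsN coef_alt -(expr1 X) coef_Xn.
by case: eqP => [->|_]; rewrite ?mulr0 ?oppr0 ?mulr1 ?expr1.
Qed.

Lemma alt_eqmod N a b : eqmod N a b -> eqmod N (alt a) (alt b).
Proof. by move=> ab n /ab /= ->. Qed.

(** The derivation X d/dX, not a theta series. *)
Definition theta (a : fps) := Fps (fun n => a n *+ n).

Lemma coef_theta a n : theta a n = a n *+ n. Proof. by []. Qed.

Lemma thetaM a b : theta (a * b) = theta a * b + a * theta b.
Proof.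
apply: fpsP => n; rewrite fpsD coef_theta !fps_sumM -sumrMnl -big_split /=.
apply: eq_bigr => i _; rewrite mulrnAl mulrnAr -mulrnDr subnKC //.
by rewrite -ltnS.
Qed.

Lemma thetaD a b : theta (a + b) = theta a + theta b.
Proof. by apply: fpsP => n; rewrite fpsD !coef_theta fpsD mulrnDl. Qed.

Lemma theta_V k a : (0 < k)%N -> theta (V k a) = k%:R * V k (theta a).
Proof.
move=> k0; apply: fpsP => n; rewrite mulr_natl fps_mulrn /=.
case: ifP => [/dvdnP[m ->]|_]; last by rewrite !mul0rn.
by rewrite mulnK // mulrnA.
Qed.

Lemma theta_Xn k : theta (X ^+ k) = k%:R * X ^+ k.
Proof.
apply: fpsP => n; rewrite mulr_natl fps_mulrn coef_theta coef_Xn.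
by case: eqP => [->|_]; rewrite ?mul0rn.
Qed.

Definition sect (k r : nat) (a : fps) := Fps (fun n => a (k * n + r)%N).

Lemma coef_sect k r a n : sect k r a n = a (k * n + r)%N. Proof. by []. Qed.

Lemma coef_XnV k j r (b : fps) m : (j < k)%N -> (r < k)%N ->
  (X ^+ j * V k b) (k * m + r)%N = if r == j then b m else 0.
Proof.
move=> ltjk ltrk; have k0 : (0 < k)%N by case: k ltjk {ltrk}.
rewrite coef_XnM; case: ltnP => [lt_j|le_j].
  by case: eqP => // rj; move: lt_j; rewrite rj; lia.
case: eqP => [->|/eqP neq]; first by rewrite addnK coef_V.
rewrite /= ifN //; apply: contra neq => dvd.
have: (k * m + r = j %[mod k])%N.
  by apply/eqP; rewrite eqn_mod_dvd.
by rewrite mulnC modnMDl !modn_small // => ->.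
Qed.

Lemma dissect3 (a : fps) :
  a = V 3 (sect 3 0 a) + X * V 3 (sect 3 1 a) + X ^+ 2 * V 3 (sect 3 2 a).
Proof.
apply: fpsP => n; rewrite (divn_eq n 3) mulnC.
have := ltn_pmod n (isT : (0 < 3)%N); move: (n %% 3)%N (n %/ 3)%N => r m ltr.
rewrite !fpsD -[V 3 (sect 3 0 a)]mul1r -(expr0 X) -[X in X * V 3 (sect 3 1 a)]expr1.
by rewrite !coef_XnV //; case: r ltr => [|[|[|]]] //=; rewrite ?addr0 ?add0r.
Qed.

Lemma sect3E (a b c : fps) r : (r < 3)%N ->
  sect 3 r (V 3 a + X * V 3 b + X ^+ 2 * V 3 c) = nth 0 [:: a; b; c] r.
Proof.
move=> ltr; apply: fpsP => n.
rewrite coef_sect !fpsD -[V 3 a]mul1r -(expr0 X) -[X in X * V 3 b]expr1.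
by rewrite !coef_XnV //; case: r ltr => [|[|[|]]] //=; rewrite ?addr0 ?add0r.
Qed.

Lemma sect_eqmod k r N a b :
  (r < k)%N -> eqmod (k * N) a b -> eqmod N (sect k r a) (sect k r b).
Proof.
move=> ltrk ab n ltnN; apply: ab.
apply: (@leq_trans (k * n.+1)); first by rewrite mulnS addnC ltn_add2r.
by rewrite leq_mul2l ltnN orbT.
Qed.

(* If a = V3 a0 + X V3 a1 + X^2 V3 a2, then V3 (norm3 a) is the product of the
   conjugates a(w X), for w the cube roots of unity. *)
Definition norm3 (a : fps) : fps :=
  let a0 := sect 3 0 a in let a1 := sect 3 1 a in let a2 := sect 3 2 a in
  a0 ^+ 3 + X * a1 ^+ 3 + X ^+ 2 * a2 ^+ 3 - 3%:R * X * a0 * a1 * a2.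

Lemma norm3E a0 a1 a2 :
  norm3 (V 3 a0 + X * V 3 a1 + X ^+ 2 * V 3 a2) =
  a0 ^+ 3 + X * a1 ^+ 3 + X ^+ 2 * a2 ^+ 3 - 3%:R * X * a0 * a1 * a2.
Proof. by rewrite /norm3 !sect3E. Qed.

(** Multiplicativity is what lets the norm of an eta quotient be computed factor by factor. The
    components of [a * b] collect exponents by residue modulo 3, an X^3 becoming X inside [V 3]. *)
Lemma norm3M a b : norm3 (a * b) = norm3 a * norm3 b.
Proof.
rewrite {1}(dissect3 a) {1}(dissect3 b).
set a0 := sect 3 0 a; set a1 := sect 3 1 a; set a2 := sect 3 2 a.
set b0 := sect 3 0 b; set b1 := sect 3 1 b; set b2 := sect 3 2 b.
rewrite [X in norm3 X](_ : _ = V 3 (a0 * b0 + X * (a1 * b2 + a2 * b1)) +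
    X * V 3 (a0 * b1 + a1 * b0 + X * (a2 * b2)) +
    X ^+ 2 * V 3 (a0 * b2 + a1 * b1 + a2 * b0)).
  by rewrite norm3E /norm3 -/a0 -/a1 -/a2 -/b0 -/b1 -/b2; ring.
by rewrite !(rmorphD, rmorphM) /= V_X //; ring.
Qed.

Lemma norm3_1 : norm3 1 = 1.
Proof.
have -> : (1 : fps) = V 3 1 + X * V 3 0 + X ^+ 2 * V 3 0.
  by rewrite !(rmorph0, rmorph1) !mulr0 !addr0.
by rewrite norm3E; ring.
Qed.

Lemma norm3_V3 a : norm3 (V 3 a) = a ^+ 3.
Proof.
have -> : V 3 a = V 3 a + X * V 3 0 + X ^+ 2 * V 3 0.
  by rewrite !rmorph0 !mulr0 !addr0.
by rewrite norm3E; ring.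
Qed.

(** The substitution X -> X^2 sends w to w^2 and so permutes the conjugates; concretely the
    components of residues 1 and 2 trade places. *)
Lemma norm3_V2 a : norm3 (V 2 a) = V 2 (norm3 a).
Proof.
rewrite {1}(dissect3 a) /norm3.
set a0 := sect 3 0 a; set a1 := sect 3 1 a; set a2 := sect 3 2 a.
have -> : V 2 (V 3 a0 + X * V 3 a1 + X ^+ 2 * V 3 a2) =
    V 3 (V 2 a0) + X * V 3 (X * V 2 a2) + X ^+ 2 * V 3 (V 2 a1).
  by rewrite !(rmorphD, rmorphM, rmorphXn) /= !V_V // !V_X //; ring.
rewrite -/(norm3 _) norm3E !(rmorphB, rmorphD, rmorphM, rmorphXn,
  rmorph_nat) /=.
by rewrite !V_X //; ring.
Qed.

(** For n prime to 3 the conjugates are 1 - w^j X^n, with product 1 - X^(3n), which is [V 3] of the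
    right-hand side. *)
Lemma norm3_X1 n : ~~ (3 %| n)%N -> norm3 (1 - X ^+ n) = 1 - X ^+ n.
Proof.
move=> ndvd; have : (n %% 3 < 3)%N by rewrite ltn_mod.
move: ndvd; rewrite {3 4}(divn_eq n 3) mulnC /dvdn.
move: (n %% 3)%N (n %/ 3)%N => r m; case: r => [|[|[|]]] //= _ _.
  have E : 1 - X ^+ (3 * m + 1) =
      V 3 1 + X * V 3 (- X ^+ m) + X ^+ 2 * V 3 0.
    rewrite !(rmorphN, rmorph0, rmorph1, rmorphXn) /= V_X // exprD exprM; ring.
  by rewrite {1}E norm3E exprD (mulnC 3%N) exprM; ring.
have E : 1 - X ^+ (3 * m + 2) =
    V 3 1 + X * V 3 0 + X ^+ 2 * V 3 (- X ^+ m).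
  rewrite !(rmorphN, rmorph0, rmorph1, rmorphXn) /= V_X // exprD exprM; ring.
by rewrite {1}E norm3E exprD (mulnC 3%N) exprM; ring.
Qed.

Lemma norm3_eqmod N a b : eqmod (3 * N) a b -> eqmod N (norm3 a) (norm3 b).
Proof.
move=> ab.
have ab_ r : (r < 3)%N -> eqmod N (sect 3 r a) (sect 3 r b).
  by move=> ltr; apply: sect_eqmod.
have [a0 a1 a2] := And3 (ab_ 0%N isT) (ab_ 1%N isT) (ab_ 2%N isT).
have X3 c d : eqmod N c d -> eqmod N (c ^+ 3) (d ^+ 3).
  by move=> cd; rewrite !exprS !expr0 !mulr1; do 2?apply: eqmodM.
rewrite /norm3 -!mulNr.
by do ![apply: eqmodD | apply: eqmodM | apply: X3 | assumption | exact: eqmod_refl].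
Qed.

(** * Infinite products, theta series and the Jacobi triple product *)

Lemma big_ord_mul (R : Type) (idx : R) (op : Monoid.law idx) N k (F : nat -> R) :
  \big[op/idx]_(i < N * k) F i =
  \big[op/idx]_(j < N) \big[op/idx]_(i < k) F (j * k + i)%N.
Proof.
elim: N => [|N IHN]; first by rewrite mul0n !big_ord0.
rewrite big_ord_recr /= -IHN -!(big_mkord xpredT F) mulSnr.
rewrite (big_cat_nat (n := (N * k)%N)) ?leq_addr //=; congr (op _ _).
rewrite -{1}[(N * k)%N]add0n big_addn addKn big_mkord.
by apply: eq_bigr => i _; rewrite addnC.
Qed.

(** Coefficient n uses only the factors of index at most n. This is the infinite product as soon as
    [eqmod j.+1 (u j) 1] for all j, the recurring hypothesis below; [psum] likewise relies on
    [i <= g i]. *)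
Definition iprod (u : nat -> fps) := Fps (fun n => (\prod_(i < n.+1) u i) n).

Definition psum (g : nat -> nat) : fps :=
  Fps (fun n => (\sum_(i < n.+1) X ^+ g i) n).

Lemma iprod_trunc (u : nat -> fps) N M :
  (forall j, eqmod j.+1 (u j) 1) -> (N <= M)%N ->
  eqmod N (iprod u) (\prod_(i < M) u i).
Proof.
move=> u1 leNM n ltnN; have ltnM := leq_trans ltnN leNM.
rewrite -[LHS]/((\prod_(i < n.+1) u i) n) -!(big_mkord xpredT u).
rewrite [in RHS](big_cat_nat (n := n.+1)) //=.
rewrite -[\prod_(0 <= i < n.+1) u i in LHS]mulr1; apply: (@eqmodM n.+1) => //.
apply: eqmod_sym; rewrite big_nat_cond.
apply: eqmod_prod1 => i /andP[/andP[ltni _] _].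
by apply: eqmod_le (u1 i); rewrite ltnS ltnW.
Qed.

Lemma eq_iprod (u v : nat -> fps) : u =1 v -> iprod u = iprod v.
Proof.
by move=> uv; apply: fpsP => n /=; congr (coefs _ _); apply: eq_bigr.
Qed.

Lemma eqmod_mul1 N a b : eqmod N a 1 -> eqmod N b 1 -> eqmod N (a * b) 1.
Proof. by move=> a1 b1; rewrite -[1]mulr1; apply: eqmodM. Qed.

Lemma iprodM (u v : nat -> fps) :
  (forall j, eqmod j.+1 (u j) 1) -> (forall j, eqmod j.+1 (v j) 1) ->
  iprod u * iprod v = iprod (fun j => u j * v j).
Proof.
move=> u1 v1; apply: eqmodP => N.
apply: (@eqmod_trans _ ((\prod_(i < N) u i) * \prod_(i < N) v i)).
  by apply: eqmodM; apply: iprod_trunc.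
rewrite -big_split; apply: eqmod_sym; apply: iprod_trunc => // j.
by apply: eqmod_mul1.
Qed.

Lemma iprod_group k (u : nat -> fps) : (0 < k)%N ->
  (forall j, eqmod j.+1 (u j) 1) ->
  iprod u = iprod (fun j => \prod_(i < k) u (j * k + i)%N).
Proof.
move=> k0 u1; apply: eqmodP => N.
apply: (@eqmod_trans _ (\prod_(i < N * k) u i)).
  by apply: iprod_trunc => //; rewrite leq_pmulr.
rewrite big_ord_mul; apply: eqmod_sym; apply: iprod_trunc => // j.
apply: eqmod_prod1 => i _; apply: eqmod_le (u1 _).
by rewrite ltnS (leq_trans _ (leq_addr _ _)) // leq_pmulr.
Qed.

Lemma V_iprod k (u : nat -> fps) : (0 < k)%N ->
  (forall j, eqmod j.+1 (u j) 1) -> V k (iprod u) = iprod (fun j => V k (u j)).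
Proof.
move=> k0 u1; apply: eqmodP => N.
apply: (@eqmod_trans _ (V k (\prod_(i < N) u i))).
  by apply: V_eqmod => //; apply: iprod_trunc.
rewrite rmorph_prod; apply: eqmod_sym; apply: iprod_trunc => // j.
by rewrite -(rmorph1 (V k)); apply: V_eqmod.
Qed.

Lemma alt_iprod (u : nat -> fps) :
  (forall j, eqmod j.+1 (u j) 1) -> alt (iprod u) = iprod (fun j => alt (u j)).
Proof.
move=> u1; apply: eqmodP => N.
apply: (@eqmod_trans _ (alt (\prod_(i < N) u i))).
  by apply: alt_eqmod => //; apply: iprod_trunc.
rewrite rmorph_prod; apply: eqmod_sym; apply: iprod_trunc => // j.
by rewrite -(rmorph1 alt); apply: alt_eqmod.
Qed.

Lemma iprod_0 (u : nat -> fps) : (forall j,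
  eqmod j.+1 (u j) 1) -> iprod u 0%N = 1.
Proof.
move=> u1; rewrite (@iprod_trunc u 1 1) // big_ord1.
by rewrite (u1 0%N) // fps_1.
Qed.

Lemma eqmod_addXn N k (c : fps) : (N <= k)%N -> eqmod N (1 + c * X ^+ k) 1.
Proof.
move=> leNk; rewrite -[X in eqmod _ _ X]addr0 mulrC.
by apply: eqmodD => //; apply: eqmod_Xn0.
Qed.

Lemma eqmod_1pXn N k : (N <= k)%N -> eqmod N (1 + X ^+ k) 1.
Proof. by move=> leNk; rewrite -[X ^+ k]mul1r; apply: eqmod_addXn. Qed.

Lemma eqmod_1mXn N k : (N <= k)%N -> eqmod N (1 - X ^+ k) 1.
Proof. by move=> leNk; rewrite -mulN1r; apply: eqmod_addXn. Qed.

Lemma psum_trunc (g : nat -> nat) N M :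
  (forall i, (i <= g i)%N) -> (N <= M)%N ->
  eqmod N (psum g) (\sum_(i < M) X ^+ g i).
Proof.
move=> leg leNM n ltnN; have ltnM := leq_trans ltnN leNM.
rewrite -[LHS]/((\sum_(i < n.+1) X ^+ g i) n).
rewrite -!(big_mkord xpredT (fun i => X ^+ g i)).
rewrite [in RHS](big_cat_nat (n := n.+1)) //= [X in _ = _ + X]fps_sum.
rewrite [X in _ = _ + X]big_nat_cond [X in _ = _ + X]big1 ?addr0 //.
move=> i /andP[/andP[ltni _] _]; rewrite coef_Xn; case: eqP => // ng.
by have := leg i; rewrite -ng leqNgt ltni.
Qed.

Lemma eq_psum (g h : nat -> nat) : g =1 h -> psum g = psum h.
Proof.
move=> gh; apply: fpsP => n /=; congr (coefs _ _).
by apply: eq_bigr => i _; rewrite gh.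
Qed.

Lemma psum_group k (g : nat -> nat) : (0 < k)%N -> (forall i, (i <= g i)%N) ->
  psum g = \sum_(i < k) psum (fun j => g (j * k + i)%N).
Proof.
move=> k0 leg; apply: eqmodP => N.
apply: (@eqmod_trans _ (\sum_(i < N * k) X ^+ g i)).
  by apply: psum_trunc => //; rewrite leq_pmulr.
rewrite (big_ord_mul _ _ _ (fun i => X ^+ g i)) exchange_big /=.
apply: eqmod_sum => i _; apply: eqmod_sym; apply: psum_trunc => // j.
by apply: leq_trans (leg _); rewrite (leq_trans _ (leq_addr _ _)) // leq_pmulr.
Qed.

Lemma psum_addn c (g : nat -> nat) : (forall i, (i <= g i)%N) ->
  psum (fun i => c + g i)%N = X ^+ c * psum g.
Proof.
move=> leg; apply: eqmodP => N.
apply: (@eqmod_trans _ (\sum_(i < N) X ^+ (c + g i))).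
  by apply: psum_trunc => // i; rewrite (leq_trans (leg i)) ?leq_addl.
apply: eqmod_sym; apply: (@eqmod_trans _ (X ^+ c * \sum_(i < N) X ^+ g i)).
  by apply: eqmodM => //; apply: psum_trunc.
by rewrite mulr_sumr => n _; congr (coefs _ _); apply: eq_bigr => i _;
  rewrite exprD.
Qed.

Lemma psum_muln k (g : nat -> nat) : (0 < k)%N -> (forall i, (i <= g i)%N) ->
  psum (fun i => k * g i)%N = V k (psum g).
Proof.
move=> k0 leg; apply: eqmodP => N.
apply: (@eqmod_trans _ (\sum_(i < N) X ^+ (k * g i))).
  by apply: psum_trunc => // i; rewrite (leq_trans (leg i)) ?leq_pmull.
apply: eqmod_sym; apply: (@eqmod_trans _ (V k (\sum_(i < N) X ^+ g i))).
  by apply: V_eqmod => //; apply: psum_trunc.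
rewrite rmorph_sum => n _; congr (coefs _ _); apply: eq_bigr => i _.
by rewrite rmorphXn /= V_X // exprM.
Qed.

Lemma psum_recl (g : nat -> nat) : (forall i, (i <= g i)%N) ->
  psum g = X ^+ g 0%N + psum (fun i => g i.+1).
Proof.
move=> leg; apply: eqmodP => N.
apply: (@eqmod_trans _ (\sum_(i < N.+1) X ^+ g i)); first exact: psum_trunc.
rewrite big_ord_recl; apply: eqmodD => //; apply: eqmod_sym.
by apply: psum_trunc => // i; rewrite (leq_trans _ (leg _)).
Qed.

Lemma psum_0 (g : nat -> nat) : (forall i, (i <= g i)%N) ->
  psum g 0%N = (g 0%N == 0%N)%:R.
Proof.
by move=> leg; rewrite (@psum_trunc g 1 1) // big_ord1 coef_Xn eq_sym.
Qed.

Lemma coef_psum_neq0 (g : nat -> nat) n : psum g n != 0 -> exists i, g i = n.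
Proof.
move=> gn; apply/not_existsP => g_n; case/negP: gn.
rewrite -[psum g n]/((\sum_(i < n.+1) X ^+ g i) n) fps_sum big1 // => i _.
by rewrite coef_Xn; case: eqP => // E; case: (g_n i).
Qed.

Lemma big_center (R : Type) (idx : R) (op : Monoid.com_law idx) N M
    (F : nat -> R) :
  \big[op/idx]_(i < N + M) F i =
  op (\big[op/idx]_(j < N) F (N - j.+1)%N) (\big[op/idx]_(j < M) F (N + j)%N).
Proof.
rewrite big_split_ord /=; congr (op _ _).
by rewrite (reindex_inj rev_ord_inj).
Qed.

(** * Gaussian binomials and the q-binomial theorem *)

Section GaussBinomial.
Variable Q : fps.

(** The truncated exponent [n' - k'] does no harm, since [gauss n' k'] is 0 when n' < k'. *)
Fixpoint gauss (n k : nat) : fps :=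
  match n, k with
  | _, 0 => 1
  | 0, _.+1 => 0
  | n'.+1, k'.+1 => gauss n' k'.+1 + Q ^+ (n' - k') * gauss n' k'
  end.

Definition qfact (n : nat) := \prod_(i < n) (1 - Q ^+ i.+1).

Lemma gauss0 n : gauss n 0 = 1. Proof. by case: n. Qed.

Lemma gauss_small n k : (n < k)%N -> gauss n k = 0.
Proof.
elim: n k => [|n IHn] [|k] //= ltnk.
by rewrite !IHn ?mulr0 ?addr0 // ltnW.
Qed.

Lemma qfactS n : qfact n.+1 = qfact n * (1 - Q ^+ n.+1).
Proof. exact: big_ord_recr. Qed.

Lemma gauss_qfact n k : (k <= n)%N ->
  gauss n k * (qfact k * qfact (n - k)) = qfact n.
Proof.
elim: n k => [|n IHn] [|k] // lekn.
- by rewrite gauss0 subn0 /qfact big_ord0; ring.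
- by rewrite gauss0 subn0 {1}/qfact big_ord0; ring.
have := IHn k lekn; rewrite /= subSS; have [->|neq] := eqVneq k n.
  rewrite (@gauss_small n n.+1) // subnn expr0 qfactS => E; rewrite -[in RHS]E;
    ring.
have ltkn : (k < n)%N by lia.
have := IHn k.+1 ltkn.
rewrite -[(n - k)%N]prednK ?subn_gt0 // -subnS !qfactS => IH1 IH0.
(* With d = n - k, this splits 1 - Q^(n+1) as (1 - Q^d) + Q^d (1 - Q^(k+1)), matching the two terms
   of the recursion. *)
rewrite [RHS](_ : _ = (1 - Q ^+ (n - k.+1).+1) * qfact n +
  Q ^+ (n - k.+1).+1 * (1 - Q ^+ k.+1) * qfact n).
  rewrite -{1}IH1 -IH0; ring.
have -> : n.+1 = ((n - k.+1).+1 + k.+1)%N by lia.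
rewrite exprD; ring.
Qed.

(** The form homogeneous in y and z allows y = Q^N in the finite triple product, where y = 1 would
    call for negative exponents. *)
Lemma gauss_theorem (y z : fps) n :
  \prod_(i < n) (y + z * Q ^+ i) =
  \sum_(k < n.+1) Q ^+ 'C(k, 2) * gauss n k * z ^+ k * y ^+ (n - k).
Proof.
elim: n => [|n IHn]; first by rewrite big_ord0 big_ord1 /=; ring.
rewrite big_ord_recr /= {}IHn [RHS]big_ord_recl /= mulrDr.
under [X in _ = _ + X]eq_bigr => k _.
  rewrite /bump leq0n add1n subSS /= mulrDr 2!mulrDl.
over.
rewrite big_split /= [X in _ = _ + (X + _)]big_ord_recr /=.
rewrite (@gauss_small n n.+1) // mulr0 !mul0r addr0 addrA; congr (_ + _).
  rewrite big_distrl /= big_ord_recl /= gauss0 !subn0 exprSr !bin0n expr0.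
  congr (_ + _); first by rewrite !mulrA.
  apply: eq_bigr => k _; rewrite /bump leq0n add1n add0n.
  have -> : (n - k = (n - k.+1).+1)%N by have := ltn_ord k; lia.
  by rewrite (exprSr y); ring.
rewrite big_distrl /=; apply: eq_bigr => k _; rewrite add0n.
have -> : Q ^+ n = Q ^+ k * Q ^+ (n - k).
  by rewrite -exprD subnKC // -ltnS.
by rewrite binS bin1 exprD (exprS z); ring.
Qed.

End GaussBinomial.

(* Ramanujan's f(X^r, X^s), the sum of X^(r m(m+1)/2 + s m(m-1)/2) over all
   integers m. *)
Definition texp r s m := (r * 'C(m.+1, 2) + s * 'C(m, 2))%N.
Definition ramf r s : fps := psum (texp r s) + psum (fun m => texp s r m.+1).

Lemma leq_texp r s m : (0 < r)%N -> (m <= texp r s m)%N.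
Proof.
by move=> r0; rewrite /texp binS bin1; case: r r0 => // r _; nia.
Qed.

(** Apply the q-binomial theorem to the 2N factors Q^N + X^r Q^i and centre the indices at N. A
    factor with i >= N releases Q^N and leaves 1 + X^r Q^(i-N); one with i < N releases X^r Q^i and
    leaves 1 + X^s Q^(N-1-i). The total power released is X^S. *)
Lemma finite_jacobi r s N :
  \prod_(j < N) ((1 + X ^+ (r + (r + s) * j)) * (1 + X ^+ (s + (r + s) * j))) =
  \sum_(m < N.+1) X ^+ texp r s m * gauss (X ^+ (r + s)) (N + N) (N + m) +
  \sum_(m < N) X ^+ texp s r m.+1 * gauss (X ^+ (r + s)) (N + N) (N - m.+1).
Proof.
set Q := X ^+ (r + s); pose S := ((r + s) * ('C(N, 2) + N * N) + r * N)%N.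
apply: (@fps_XnI S).
transitivity (\prod_(i < N + N) (Q ^+ N + X ^+ r * Q ^+ i)).
  rewrite (big_center _ _ _ (fun i => Q ^+ N + X ^+ r * Q ^+ i)) -big_split /=.
  have -> : X ^+ S = \prod_(j < N) (X ^+ r * Q ^+ (N + (N - j.+1))).
    rewrite big_split /= prodr_const card_ord -exprM /Q;
      under eq_bigr do rewrite -exprM.
    rewrite -!expr_sum -exprD; congr (X ^+ _); rewrite /S addnC;
      congr (_ + _)%N.
    rewrite -big_distrr /=; congr (_ * _)%N;
      rewrite big_split /= sum_nat_const card_ord addnC.
    congr (_ + _)%N; rewrite -bin2_sum big_mkord.
    by rewrite [LHS](reindex_inj rev_ord_inj).
  rewrite -big_split /=; apply: eq_bigr => j _.
  have ltjN := ltn_ord j.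
  have QE : Q = X ^+ r * X ^+ s by rewrite /Q exprD.
  have EN : Q ^+ N = X ^+ r * X ^+ s * Q ^+ (N - j.+1) * Q ^+ j.
    by rewrite -QE -[in LHS](subnK ltjN) exprD exprS; ring.
  have EX a : X ^+ (a + (r + s) * j) = X ^+ a * Q ^+ j by rewrite exprD exprM.
  by rewrite !EX !(exprD Q) {2}EN; ring.
rewrite gauss_theorem -addnS.
rewrite (big_center _ _ _ (fun k => Q ^+ 'C(k, 2) * gauss Q (N +
  N) k * (X ^+ r) ^+ k
   * (Q ^+ N) ^+ (N + N - k))) /= addrC mulrDr.
have EX k e : (k <= N + N)%N ->
   (S + e = (r + s) * 'C(k, 2) + r * k + (r + s) * (N * (N + N - k)))%N ->
   Q ^+ 'C(k, 2) * gauss Q (N + N) k * (X ^+ r) ^+ k * (Q ^+ N) ^+ (N + N - k) =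
   X ^+ S * (X ^+ e * gauss Q (N + N) k).
  move=> lek E; rewrite mulrA -exprD E !exprD /Q -!exprM; ring.
have bin2E k : ('C(k.+1, 2) = k + 'C(k, 2))%N by rewrite binS bin1 addnC.
have binD k l : ('C(k + l, 2) = 'C(k, 2) + 'C(l, 2) + k * l)%N.
  by elim: k => [|k IHk]; [rewrite !add0n mul0n addn0 | rewrite addSn !bin2E IHk; ring].
congr (_ + _); rewrite mulr_sumr; apply: eq_bigr => -[m /= ltm] _.
  apply: EX; first by lia.
  rewrite /S /texp binD bin2E; have -> : (N + N - (N + m) = N - m)%N by lia.
  have [p ->] : exists p, N = (m + p)%N by exists (N - m)%N; lia.
  rewrite addKn; ring.
apply: EX; first by lia.
rewrite /S /texp; have [p E] : exists p, N = (p + m.+1)%N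
  by exists (N - m.+1)%N; lia.
rewrite E; have -> : (p + m.+1 + (p + m.+1) - (p + m.+1 - m.+1) = p + m.+1 +
  m.+1)%N by lia.
have sq : (m + 2 * 'C(m, 2) = m * m)%N.
  by elim: (m) => [|k IHk] //; rewrite bin2E; nia.
have := congr1 (muln r) sq; have := congr1 (muln s) sq.
rewrite addnK binD !bin2E; nia.
Qed.

Lemma jacobi_triple r s : (0 < r)%N -> (0 < s)%N ->
  ramf r s = iprod (fun j => (1 + X ^+ (r + (r + s) * j)) *
    (1 + X ^+ (s + (r + s) * j)) * (1 - X ^+ ((r + s) * j.+1))).
Proof.
move=> r0 s0; have rs0 : (0 < r + s)%N by lia.
pose u j := (1 + X ^+ (r + (r + s) * j)) * (1 + X ^+ (s + (r + s) * j)).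
pose v j := 1 - X ^+ ((r + s) * j.+1).
have u1 j : eqmod j.+1 (u j) 1.
  by apply: eqmod_mul1; apply: eqmod_1pXn; nia.
have v1 j : eqmod j.+1 (v j) 1 by apply: eqmod_1mXn; nia.
rewrite -[RHS](iprodM u1 v1) mulrC.
set E := iprod v; have E0 : E 0%N = 1 by apply: iprod_0.
(* Modulo X^l the three factorials of [gauss_qfact] all agree with [E], so E^2 times the binomial is
   [E], and one [E] cancels. *)
have EG N k l : (l <= k)%N -> (k + l = N + N)%N ->
    eqmod l (E * gauss (X ^+ (r + s)) (N + N) k) 1 /\
    eqmod l (E * gauss (X ^+ (r + s)) (N + N) l) 1.
  move=> lelk ekl.
  have EM M : (l <= M)%N -> eqmod l E (qfact (X ^+ (r + s)) M).
    move=> leM; have := @iprod_trunc v l M v1 leM.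
    by congr (eqmod _ _ _); apply: eq_bigr => i _; rewrite /v exprM.
  have [F EF] := fps_inv E0.
  have cancel x : eqmod l (x * (E * E)) E -> eqmod l (E * x) 1.
    move=> xEE; apply: (@eqmod_trans _ (F * (x * (E * E)))).
      by rewrite [X in eqmod _ _ X](_ : _ = E * F * (E * x));
        [rewrite EF mul1r | ring].
    by apply: (@eqmod_trans _ (F * E)); [exact: eqmodM | rewrite mulrC EF].
  have EQ i : (i = k \/ i = l) -> eqmod l (gauss (X ^+ (r + s)) (N +
    N) i * (E * E)) E.
    move=> ikl; apply: (@eqmod_trans _ (qfact (X ^+ (r + s)) (N + N))).
      rewrite -(@gauss_qfact _ (N + N) i); last by lia.
      by apply: eqmodM => //; apply: eqmodM; apply: EM; lia.
    by apply/eqmod_sym/EM; lia.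
  by split; apply: cancel; apply: EQ; [left | right].
apply: eqmodP => N; apply: eqmod_sym.
apply: (@eqmod_trans _ (E * \prod_(j < N) u j)).
  by apply: eqmodM => //; apply: iprod_trunc.
rewrite finite_jacobi mulrDr !mulr_sumr.
apply: (@eqmod_trans _ (\sum_(m < N.+1) X ^+ texp r s m +
                        \sum_(m < N) X ^+ texp s r m.+1)); last first.
  apply: eqmod_sym; apply: eqmodD.
    by apply: psum_trunc => // i; apply: leq_texp.
  by apply: psum_trunc => // i; apply/ltnW/leq_texp.
(* Here l = N - m falls short of N by m (or m+1), and the factor [X ^+ t] makes up for it because
   the theta exponent t is at least as large. *)
have step t l x : (N <= t + l)%N -> eqmod l (E * x) 1 ->
    eqmod N (E * (X ^+ t * x)) (X ^+ t).
  move=> leN Ex; rewrite mulrCA -[X in eqmod _ _ X]mulr1.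
  by apply: eqmod_XnM; apply: eqmod_le Ex; lia.
apply: eqmodD; apply: eqmod_sum => m _; have ltm := ltn_ord m.
  have [|//|Em _] := EG N (N + m)%N (N - m)%N; try lia.
  by apply: step Em; have := @leq_texp r s m r0; lia.
have [|//|_ Em] := EG N (N + m.+1)%N (N - m.+1)%N; try lia.
by apply: step Em; have := @leq_texp s r m.+1 s0; lia.
Qed.

(** * Theta functions as eta quotients *)

Definition squares : fps := psum (fun m => m.+1 ^ 2)%N.
HB.lock Definition phi : fps := 1 + 2%:R * squares.
Definition psi : fps := psum (fun m => 'C(m.+1, 2)).
HB.lock Definition pent : fps := ramf 2 1.
HB.lock Definition omega : fps :=
  psum (fun m => 3 * m ^ 2 + 2 * m)%N + psum (fun m => 3 * m ^ 2 + 4 * m + 1)%N.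

Lemma mul2_bin2 m : (2 * 'C(m.+1, 2) = m * m.+1)%N.
Proof. by elim: m => [|m IHm] //; rewrite binS bin1; lia. Qed.

Lemma leq_tri m : (m <= 'C(m.+1, 2))%N.
Proof. by rewrite binS bin1 leq_addl. Qed.

Lemma leq_sq m : (m <= m.+1 ^ 2)%N. Proof. by nia. Qed.

Lemma mul2_texp r s m : (2 * texp r s m = m * (r * m.+1 + s * m.-1))%N.
Proof.
rewrite /texp; case: m => [|m]; first by rewrite /= !bin_small ?muln0.
have := mul2_bin2 m; have := mul2_bin2 m.+1; rewrite /=; nia.
Qed.

Lemma phi_ramf : phi = ramf 1 1.
Proof.
have E m : texp 1 1 m = (m ^ 2)%N by have := mul2_texp 1 1 m; case: m => *; nia.
rewrite phi.unlock /ramf /squares (@eq_psum _ _ E) (eq_psum (fun m => E m.+1)).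
rewrite [X in _ = X + _]psum_recl => [|i]; last by nia.
by rewrite exp0n // expr0; ring.
Qed.

Lemma psi_ramf : psi = ramf 3 1.
Proof.
rewrite /psi (@psum_group 2) //; last exact: leq_tri.
rewrite big_ord_recl big_ord1 /ramf; congr (_ + _); apply: eq_psum => m /=.
  rewrite addn0; have := mul2_bin2 (m * 2); have := mul2_texp 3 1 m.
  by case: m => [|m] /=; nia.
rewrite /bump /= ?addn0; have := mul2_bin2 (m * 2 + 1).
have := mul2_texp 1 3 m.+1; rewrite /=; nia.
Qed.

(** The triangular number of index 3m+1 is 9 T(m) + 1; the indices 3m and 3m+2 give three times the
    generalized pentagonal numbers. *)
Lemma psi_dissect3 : psi = V 3 pent + X * V 9 psi.
Proof.
rewrite {1}/psi (@psum_group 3) //; last exact: leq_tri.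
rewrite !big_ord_recl big_ord0 /= addr0 addrA addrAC.
congr (_ + _); last first.
  rewrite -psum_muln //; last exact: leq_tri.
  rewrite -{1}[X]expr1 -psum_addn; last by move=> i; have := leq_tri i; lia.
  apply: eq_psum => m; rewrite /bump /= ?addn0; have := mul2_bin2 m.
  have := mul2_bin2 (m * 3 + 1); nia.
rewrite pent.unlock /ramf rmorphD /= -!psum_muln //; last 2 first.
- by move=> i; apply/ltnW/leq_texp.
- by move=> i; exact: leq_texp.
congr (_ + _); apply: eq_psum => m /=;
  rewrite /bump /= ?addn0 -?[(1 + 1)%N]/2%N.
  have := mul2_bin2 (m * 3); have := mul2_texp 2 1 m.
  by case: m => [|m] /=; nia.
have := mul2_bin2 (m * 3 + 2); have := mul2_texp 1 2 m.+1; rewrite /=; nia.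
Qed.

(** Integers prime to 3 are 3k+1 up to sign, and (3k+1)^2 = 1 + 3 (3k^2 + 2k); the two signs account
    for the factor 2. *)
Lemma phi_dissect3 : phi = V 3 (V 3 phi) + X * V 3 (2%:R * omega).
Proof.
rewrite {1}phi.unlock {1}/squares (@psum_group 3) //; last exact: leq_sq.
rewrite !big_ord_recl big_ord0 /= addr0 V_V // phi.unlock omega.unlock.
rewrite !(rmorphD, rmorphM, rmorph1, rmorph_nat) /=.
rewrite -!psum_muln //; try by move=> i; nia.
have XM g : (forall i, i <= g i)%N -> X * psum g = psum (fun i => 1 + g i)%N.
  by move=> leg; rewrite psum_addn // expr1.
rewrite [X * _]mulrCA [X * (_ + _)]mulrDr !XM; try by move=> i; nia.
set a := psum _; set b := psum _; set c := psum _.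
rewrite (_ : psum (fun i => 9 * _)%N = c); last by apply: eq_psum => m;
  rewrite /bump /=; nia.
rewrite (_ : psum (fun i => 1 + 3 * (_ + 2 * _))%N = a);
  last by apply: eq_psum => m; nia.
rewrite (_ : psum (fun i => 1 + _)%N = b); last by apply: eq_psum => m;
  rewrite /bump /=; nia.
ring.
Qed.

Lemma squares_dissect : squares = X * V 8 psi + V 4 squares.
Proof.
rewrite {1}/squares (@psum_group 2) //; last exact: leq_sq.
rewrite !big_ord_recl big_ord0 /= addr0 -psum_muln //; last exact: leq_tri.
rewrite -{1}[X]expr1 -psum_addn; last first.
  by move=> i; have := leq_tri i; lia.
rewrite -psum_muln //; last exact: leq_sq.
congr (_ + _); apply: eq_psum => m; rewrite /bump /=; last by nia.
have := mul2_bin2 m; nia.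
Qed.

(** * Euler products and the theta series as eta quotients *)

Definition euler : fps := iprod (fun j => 1 - X ^+ j.+1).
Definition euler_plus : fps := iprod (fun j => 1 + X ^+ j.+1).
Definition euler_odd : fps := iprod (fun j => 1 + X ^+ (2 * j).+1).

Ltac eqmod1 := move=> *; repeat apply: eqmod_mul1;
  solve [apply: eqmod_1pXn; lia | apply: eqmod_1mXn; lia].

Lemma V_euler k : (0 < k)%N -> V k euler = iprod (fun j => 1 - X ^+ (k * j.+1)).
Proof.
move=> k0; rewrite V_iprod // => [|j]; last exact: eqmod_1mXn.
apply: eq_iprod => j; rewrite !(rmorphB, rmorph1, rmorphXn) /= V_X //.
by rewrite exprM.
Qed.

Lemma V_euler_plus k :
  (0 < k)%N -> V k euler_plus = iprod (fun j => 1 + X ^+ (k * j.+1)).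
Proof.
move=> k0; rewrite V_iprod // => [|j]; last exact: eqmod_1pXn.
apply: eq_iprod => j; rewrite !(rmorphD, rmorph1, rmorphXn) /= V_X //.
by rewrite exprM.
Qed.

Lemma euler_0 : euler 0%N = 1.
Proof. by apply: iprod_0 => j; apply: eqmod_1mXn. Qed.

Lemma euler_plusM : euler_plus * euler = V 2 euler.
Proof.
rewrite V_euler // iprodM => [|j|j]; [|exact: eqmod_1pXn|exact: eqmod_1mXn].
by apply: eq_iprod => j; rewrite mulnC exprM; ring.
Qed.

Lemma euler_oddM : euler_odd * V 2 euler_plus = euler_plus.
Proof.
rewrite V_euler_plus // iprodM => [|j|j]; try by apply: eqmod_1pXn; lia.
rewrite [RHS](@iprod_group 2) // => [|j]; last exact: eqmod_1pXn.
apply: eq_iprod => j; rewrite !big_ord_recl big_ord0 mulr1 /= /bump /=.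
by congr ((1 + X ^+ _) * (1 + X ^+ _)); lia.
Qed.

Lemma phi_prod : phi = euler_odd ^+ 2 * V 2 euler.
Proof.
rewrite phi_ramf jacobi_triple // V_euler // expr2.
rewrite !iprodM; try eqmod1.
by apply: eq_iprod => j; rewrite !add1n.
Qed.

Lemma psi_prod : psi = euler_odd * V 4 euler.
Proof.
rewrite psi_ramf jacobi_triple // V_euler //.
rewrite [euler_odd](@iprod_group 2) //; last by eqmod1.
rewrite iprodM; try eqmod1.
  apply: eq_iprod => j; rewrite !big_ord_recl big_ord0 mulr1 /= /bump /=.
  rewrite [in LHS](mulrC (1 + X ^+ (3 + _))).
  by congr ((1 + X ^+ _) * (1 + X ^+ _) * _); lia.
by move=> j; apply: eqmod_prod1 => i _; apply: eqmod_1pXn; lia.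
Qed.

Lemma pent_prod : pent * V 3 euler_plus = euler_plus * V 3 euler.
Proof.
rewrite pent.unlock jacobi_triple // V_euler // V_euler_plus //.
rewrite [euler_plus](@iprod_group 3) //; last by eqmod1.
rewrite !iprodM; try eqmod1.
  apply: eq_iprod => j; rewrite !big_ord_recl big_ord0 mulr1 /= /bump /=.
  rewrite (_ : (2 + 3 * j = (j * 3 + (1 + 0)).+1)%N); last by lia.
  rewrite (_ : (1 + 3 * j = (j * 3 + 0).+1)%N); last by lia.
  rewrite (_ : (3 * j.+1 = (j * 3 + (1 + (1 + 0))).+1)%N); last by lia.
  by ring.
by move=> j; apply: eqmod_prod1 => i _; apply: eqmod_1pXn; lia.
Qed.

Lemma phi_euler : phi * (euler ^+ 2 * V 4 euler ^+ 2) = V 2 euler ^+ 5.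
Proof.
have e4 : V 4 euler = V 2 euler_plus * V 2 euler.
  by rewrite -rmorphM /= euler_plusM V_V.
rewrite phi_prod e4.
transitivity ((euler_odd * V 2 euler_plus * euler) ^+ 2 * V 2 euler ^+ 3);
  first by ring.
by rewrite euler_oddM euler_plusM; ring.
Qed.

Lemma psi_euler : psi * euler = V 2 euler ^+ 2.
Proof.
have e4 : V 4 euler = V 2 euler_plus * V 2 euler.
  by rewrite -rmorphM /= euler_plusM V_V.
rewrite psi_prod e4.
transitivity (euler_odd * V 2 euler_plus * euler * V 2 euler); first by ring.
by rewrite euler_oddM euler_plusM expr2.
Qed.

Lemma pent_euler : pent * (euler * V 6 euler) = V 2 euler * V 3 euler ^+ 2.
Proof.
have e6 : V 6 euler = V 3 euler_plus * V 3 euler.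
  by rewrite -rmorphM /= euler_plusM V_V.
rewrite e6.
transitivity (pent * V 3 euler_plus * euler * V 3 euler); first by ring.
rewrite pent_prod -euler_plusM; ring.
Qed.

Lemma phi_psi2 : phi * V 2 psi = psi ^+ 2.
Proof.
have p2 : V 2 psi * V 2 euler = V 4 euler ^+ 2.
  by rewrite -rmorphM /= psi_euler rmorphXn /= V_V.
apply: (@fps_mulI (euler ^+ 2 * V 4 euler ^+ 2 * V 2 euler)).
  by rewrite !(fps_M0, fps_X0) !V_0 euler_0.
transitivity (phi * (euler ^+ 2 * V 4 euler ^+ 2) * (V 2 psi * V 2 euler));
  first by ring.
rewrite phi_euler p2.
transitivity ((psi * euler) ^+ 2 * V 4 euler ^+ 2 * V 2 euler); last by ring.
rewrite psi_euler; ring.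
Qed.

(** The norm fixes the factors 1 - X^n with n prime to 3 and turns 1 - X^(3n) into (1 - X^n)^3.
    Hence it is euler^3 times the part of [euler] with exponents prime to 3, that is, times the
    quotient of [euler] by [V 3 euler]. *)
Lemma norm3_euler : norm3 euler * V 3 euler = euler ^+ 4.
Proof.
pose p N : fps := \prod_(i < N) (1 - X ^+ i.+1).
have eqp N M : (N <= M)%N -> eqmod N euler (p M).
  by move=> leNM; apply: iprod_trunc => // j; apply: eqmod_1mXn.
have pS n : p n.+1 = p n * (1 - X ^+ n.+1) by exact: big_ord_recr.
have np N : norm3 (p (3 * N)%N) * V 3 (p N) = p (3 * N)%N * p N ^+ 3.
  elim: N => [|N IHN]; first by rewrite muln0 /p !big_ord0 rmorph1 norm3_1;
    ring.
  have -> : (3 * N.+1 = (3 * N).+3)%N by lia.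
  rewrite !pS !norm3M !rmorphM !rmorphB !rmorphXn !rmorph1 /= V_X // -!exprM.
  have -> : (3 * N.+1 = (3 * N).+3)%N by lia.
  rewrite (@norm3_X1 (3 * N).+1) ?(@norm3_X1 (3 * N).+2); try lia.
  have -> : 1 - X ^+ (3 * N).+3 = V 3 (1 - X ^+ N.+1).
    rewrite rmorphB rmorphXn rmorph1 /= V_X // -exprM; congr (1 - X ^+ _); lia.
  rewrite norm3_V3.
  transitivity (norm3 (p (3 * N)%N) * V 3 (p N) * (1 - X ^+ (3 * N).+1) *
    (1 - X ^+ (3 * N).+2) * (1 - X ^+ N.+1) ^+ 3 * V 3 (1 - X ^+ N.+1));
      first by ring.
  rewrite IHN; ring.
apply: eqmodP => N; apply: (@eqmod_trans _ (norm3 (p (3 * N)%N) * V 3 (p N))).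
  apply: eqmodM; last by apply: V_eqmod => //; apply: eqp.
  by apply: norm3_eqmod; apply: eqp.
rewrite np; apply: eqmod_sym; rewrite exprS; apply: eqmodM.
  by apply: eqp; lia.
by rewrite !exprS !expr0; do ![apply: eqmodM | apply: eqp | done].
Qed.

(** The relation satisfied by [euler] also holds for [V 2 euler] and [V 4 euler]; being
    multiplicative, it passes to the eta quotient of [phi]. *)
Lemma norm3_phi : norm3 phi * V 3 phi = phi ^+ 4.
Proof.
have nV2 : norm3 (V 2 euler) * V 6 euler = V 2 euler ^+ 4.
  by rewrite norm3_V2 -(@V_V 2 3) // -rmorphM /= norm3_euler rmorphXn.
have nV4 : norm3 (V 4 euler) * V 12 euler = V 4 euler ^+ 4.
  rewrite -(@V_V 2 2) // norm3_V2 -(@V_V 2 6) // -rmorphM /= nV2.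
  by rewrite rmorphXn.
have n1 := norm3_euler.
have p3 : V 3 phi * (V 3 euler ^+ 2 * V 12 euler ^+ 2) = V 6 euler ^+ 5.
  have := congr1 (V 3) phi_euler.
  by rewrite !(rmorphM, rmorphXn) /= !V_V.
have np : norm3 phi * (norm3 euler ^+ 2 * norm3 (V 4 euler) ^+ 2) =
    norm3 (V 2 euler) ^+ 5.
  by rewrite !(exprS, expr0, mulr1) -!norm3M; congr norm3; have := phi_euler;
    rewrite !(exprS, expr0, mulr1).
apply: (@fps_mulI ((euler ^+ 4) ^+ 2 * (V 4 euler ^+ 4) ^+ 2)).
  by rewrite !(fps_M0, fps_X0) !V_0 euler_0.
rewrite -{1}n1 -{1}nV4.
transitivity (norm3 phi * (norm3 euler ^+ 2 * norm3 (V 4 euler) ^+ 2) *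
  (V 3 phi * (V 3 euler ^+ 2 * V 12 euler ^+ 2))); first by ring.
rewrite np p3.
transitivity ((norm3 (V 2 euler) * V 6 euler) ^+ 5); first by ring.
rewrite nV2.
transitivity ((phi * (euler ^+ 2 * V 4 euler ^+ 2)) ^+ 4); last by ring.
rewrite phi_euler; ring.
Qed.

Lemma phi_quartic : phi ^+ 4 = V 3 phi ^+ 4 + 8%:R * X * omega ^+ 3 * V 3 phi.
Proof.
have E : phi = V 3 (V 3 phi) + X * V 3 (2%:R * omega) + X ^+ 2 * V 3 0.
  by rewrite rmorph0 mulr0 addr0 -phi_dissect3.
by rewrite -norm3_phi {1}E norm3E; ring.
Qed.

(** * Dissections modulo 192 *)

Lemma squares_0 : squares 0%N = 0. Proof. by rewrite psum_0 //; apply: leq_sq.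
  Qed.

Lemma phi_0 : phi 0%N = 1.
Proof. by rewrite phi.unlock fpsD fps_M0 squares_0 mulr0 addr0 fps_1. Qed.

Lemma psi_0 : psi 0%N = 1. Proof. by rewrite psum_0 //; apply: leq_tri. Qed.

Lemma phi_dissect4 : phi = V 4 phi + 2%:R * X * V 8 psi.
Proof.
rewrite phi.unlock {1}squares_dissect rmorphD rmorphM rmorph1 rmorph_nat /=;
  ring.
Qed.

Lemma omega_0 : omega 0%N = 1.
Proof. by rewrite omega.unlock fpsD !psum_0 //; try by move=> i; nia. Qed.

Lemma phiE : phi = 1 + 2%:R * squares. Proof. exact: phi.unlock. Qed.

Lemma sect3_inj (a b c a' b' c' : fps) :
  V 3 a + X * V 3 b + X ^+ 2 * V 3 c = V 3 a' + X * V 3 b' + X ^+ 2 * V 3 c' ->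
  [/\ a = a', b = b' & c = c'].
Proof.
move=> E; have Es r (ltr : (r < 3)%N) : nth 0 [:: a; b; c] r = nth 0 [:: a';
  b'; c'] r.
  by rewrite -(sect3E _ _ _ ltr) E sect3E.
by split; [exact: (Es 0%N isT) | exact: (Es 1%N isT) | exact: (Es 2%N isT)].
Qed.

Lemma psi_dissect : psi = V 3 pent + X * V 3 (V 3 psi).
Proof. by rewrite {1}psi_dissect3 V_V. Qed.

(** These are the three components modulo 3 of phi(q) psi(q^2) = psi(q)^2, the middle one after
    cancelling 2. *)
Lemma phi_psi_relations :
  [/\ V 3 phi * V 2 pent + 2%:R * X * omega * V 6 psi = pent ^+ 2,
      omega * V 2 pent = pent * V 3 psi &
      V 3 phi * V 6 psi = V 3 psi ^+ 2].
Proof.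
have psi2 : V 2 psi = V 3 (V 2 pent) + X ^+ 2 * V 3 (V 6 psi).
  by rewrite {1}psi_dissect3 rmorphD rmorphM /= !V_V // V_X.
have [] := @sect3_inj
  (V 3 phi * V 2 pent + 2%:R * X * omega * V 6 psi) (2%:R * (omega * V 2 pent))
  (V 3 phi * V 6 psi) (pent ^+ 2) (2%:R * (pent * V 3 psi)) (V 3 psi ^+ 2).
  transitivity (phi * V 2 psi).
    rewrite {3}phi_dissect3 psi2 !(rmorph_nat, rmorphM, rmorphD) /= V_X //;
      ring.
  rewrite phi_psi2 {1}psi_dissect !(rmorph_nat, rmorphXn, rmorphM, rmorphD) /=.
  ring.
by move=> -> /fps_natI -> // ->.
Qed.

(** Obtained from [omega * V 2 pent = pent * V 3 psi] and the eta quotients already known, without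
    another triple product. *)
Lemma omega_euler :
  omega * (euler * V 4 euler * V 6 euler) =
    V 2 euler ^+ 2 * V 3 euler * V 12 euler.
Proof.
have [_ Op _] := phi_psi_relations.
have p2 : V 2 pent * (V 2 euler * V 12 euler) = V 4 euler * V 6 euler ^+ 2.
  by have := congr1 (V 2) pent_euler; rewrite !(rmorphXn, rmorphM) /= !V_V.
have t3 : V 3 psi * V 3 euler = V 6 euler ^+ 2.
  by have := congr1 (V 3) psi_euler; rewrite !(rmorphXn, rmorphM) /= !V_V.
apply: (@fps_mulI (V 3 euler * V 6 euler ^+ 2)).
  by rewrite !(fps_M0, fps_X0) !V_0 euler_0.
transitivity (omega * (V 4 euler * V 6 euler ^+ 2) * (euler * V 6 euler * V 3 euler)).
  by ring.
rewrite -p2.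
transitivity (omega * V 2 pent * (V 2 euler * V 12 euler * euler * V 6 euler * V 3 euler)).
  by ring.
rewrite Op.
transitivity (pent * (euler * V 6 euler) * (V 3 psi * V 3 euler) *
  (V 2 euler * V 12 euler)); first by ring.
rewrite pent_euler t3; ring.
Qed.

(** Converts the factor psi Omega^2 left by the second dissection into F phi. *)
Lemma psi_omega2 : psi * omega ^+ 2 = pent * V 6 psi * phi.
Proof.
have z6 : V 6 psi * V 6 euler = V 12 euler ^+ 2.
  by have := congr1 (V 6) psi_euler; rewrite !(rmorphXn, rmorphM) /= !V_V.
apply: (@fps_mulI (euler * (euler * V 4 euler * V 6 euler) ^+ 2)).
  by rewrite !(fps_M0, fps_X0) !V_0 euler_0.
transitivity (psi * euler * (omega * (euler * V 4 euler * V 6 euler)) ^+ 2).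
  by ring.
rewrite omega_euler psi_euler.
transitivity (pent * (euler * V 6 euler) * (V 6 psi * V 6 euler) *
  (phi * (euler ^+ 2 * V 4 euler ^+ 2))); last by ring.
rewrite pent_euler z6 phi_euler; ring.
Qed.

(* Put t = V 3 psi and a = V 3 phi: by phi_quartic, t phi^2 and
   2 P Omega a - t a^2 have the same square, and both have constant term 1. *)
Lemma pent_omega_phi :
  2%:R * pent * omega * V 3 phi = V 3 psi * (phi ^+ 2 + V 3 phi ^+ 2).
Proof.
have [r0 r1 r2] := phi_psi_relations; have r4 := phi_quartic.
set a := V 3 phi in r0 r2 r4 *; set t := V 3 psi in r1 r2 *.
set p := V 2 pent in r0 r1; set z := V 6 psi in r0 r2.
set u := t * phi ^+ 2; set v := 2%:R * pent * omega * a - t * a ^+ 2.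
have sqr : (u + v) * (u - v) = 0.
  transitivity (t ^+ 2 * phi ^+ 4 - v ^+ 2); first by rewrite /u; ring.
  rewrite r4 /v.
  transitivity (4%:R * a * omega * (2%:R * X * omega ^+ 2 * t ^+ 2 -
    a * omega * pent ^+ 2 + a ^+ 2 * (pent * t))); first by ring.
  rewrite -r1 -r0 -r2; ring.
have uv0 : (u + v) 0%N != 0.
  have z0 : z 0%N = 1 by rewrite V_0 psi_0.
  have t0 : t 0%N = 1 by rewrite V_0 psi_0.
  have a0 : a 0%N = 1 by rewrite V_0 phi_0.
  have O0 := omega_0.
  have P0 : pent 0%N = 1.
    have := congr1 (fun c : fps => c 0%N) pent_euler.
    by rewrite !(fps_M0, fps_X0) !V_0 euler_0 !mulr1.
  rewrite /v -mulNr -mulrA !fpsD !fps_M0 !fpsN.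
  by rewrite t0 a0 O0 P0 phi_0 -[2%:R]/(1 + 1) fpsD fps_1.
have uv : u - v = 0 by apply: (fps_mulI uv0); rewrite sqr mulr0.
have -> : 2%:R * pent * omega * a = v + t * a ^+ 2 by rewrite /v; ring.
by rewrite -(subr0_eq uv) /u; ring.
Qed.

(** The product phi(wX) phi(w^2 X) for a primitive cube root of unity w: writing phi = c + d X as in
    [phi_dissect3], it is c^2 - c d X + d^2 X^2. *)
Definition phi_conj : fps :=
  V 3 (V 3 phi) ^+ 2 - 2%:R * X * V 3 (V 3 phi) * V 3 omega +
  4%:R * X ^+ 2 * V 3 omega ^+ 2.

Lemma phi_conjM :
  phi * phi_conj = V 3 (V 3 phi ^+ 3 + 8%:R * X * omega ^+ 3).
Proof.
rewrite /phi_conj {1}phi_dissect3.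
rewrite !(rmorph_nat, rmorphXn, rmorphM, rmorphD) /= V_X //; ring.
Qed.

Lemma sect1_quotient (A : fps) :
  A * phi = psi -> sect 3 1 A * phi ^+ 2 = - (V 3 phi * V 3 psi).
Proof.
move=> Aphi; have r4 := phi_quartic; have rO := pent_omega_phi.
set a := V 3 phi in r4 rO *; set t := V 3 psi in rO *.
set D := a ^+ 3 + 8%:R * X * omega ^+ 3.
have dA := dissect3 A.
set A0 := sect 3 0 A in dA; set A1 := sect 3 1 A in dA *;
  set A2 := sect 3 2 A in dA.
have phiK : phi * phi_conj = V 3 D by exact: phi_conjM.
(* The right-hand sides are the components of [psi * phi_conj], which equals [A * V 3 D]. The middle
   one suffices, and D a = phi^4 brings the denominator back to [phi]. *)
have [_ E1 _] : [/\ A0 * D = pent * a ^+ 2 + 4%:R * X * t * omega ^+ 2,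
    A1 * D = t * a ^+ 2 - 2%:R * pent * a * omega &
    A2 * D = 4%:R * pent * omega ^+ 2 - 2%:R * t * a * omega].
  apply: sect3_inj.
  transitivity (A * V 3 D); first by rewrite {1}dA !rmorphM; ring.
  rewrite -phiK mulrA Aphi {1}psi_dissect -/t /phi_conj -/a.
  by rewrite !(rmorph_nat, rmorphXn, rmorphM, rmorphB, rmorphD) /= V_X //; ring.
apply: (@fps_mulI (phi ^+ 2)); first by rewrite fps_X0 phi_0.
transitivity (A1 * phi ^+ 4); first by ring.
rewrite r4; transitivity (A1 * D * a); first by rewrite /D; ring.
rewrite E1; transitivity (t * a ^+ 3 - a * (2%:R * pent * omega * a));
  first by ring.
rewrite rO; ring.
Qed.

Lemma sect12_quotient (A : fps) : A * phi = psi ->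
  sect 3 2 (sect 3 1 A) * phi ^+ 8 =
  - (12%:R * (pent * V 6 psi * (phi ^+ 2 * V 3 phi ^+ 4))).
Proof.
move=> Aphi; have r4 := phi_quartic; have E1 := sect1_quotient Aphi.
set B := sect 3 1 A in E1 *; have dB := dissect3 B.
set B0 := sect 3 0 B in dB; set B1 := sect 3 1 B in dB;
  set B2 := sect 3 2 B in dB *.
set a := V 3 phi in r4 E1 *; set t := V 3 psi in E1.
set D := a ^+ 3 + 8%:R * X * omega ^+ 3.
have phiK : phi * phi_conj = V 3 D by exact: phi_conjM.
(* The numerator V 3 phi * V 3 psi is a series in X^3, so only the square of [phi_conj] needs
   dissecting; its X^2 term 3 a^2 (2 Omega)^2 is the origin of the factor 12. *)
have [_ _ E2] : [/\ B0 * D ^+ 2 =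
  - (phi * psi * (a ^+ 4 - 16%:R * X * a * omega ^+ 3)),
    B1 * D ^+ 2 = - (phi * psi * (16%:R * X * omega ^+ 4 - 4%:R * a ^+ 3 * omega)) &
    B2 * D ^+ 2 = - (phi * psi * (12%:R * a ^+ 2 * omega ^+ 2))].
  apply: sect3_inj.
  transitivity (B * V 3 D ^+ 2).
    by rewrite {1}dB !(rmorphXn, rmorphM); ring.
  rewrite -phiK (_ : B * _ = B * phi ^+ 2 * phi_conj ^+ 2); last by ring.
  rewrite E1 /phi_conj /a /t.
  by rewrite !(rmorph_nat, rmorphXn, rmorphM, rmorphN, rmorphB,
    rmorphD) /= V_X //; ring.
transitivity (B2 * (phi ^+ 4) ^+ 2); first by ring.
rewrite r4; transitivity (B2 * D ^+ 2 * a ^+ 2); first by rewrite /D; ring.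
rewrite E2; transitivity (- (12%:R * (psi * omega ^+ 2 * (phi * a ^+ 4))));
  first by ring.
rewrite psi_omega2; ring.
Qed.

(** For n > 0, coefficient n of [V 2 a] is 0 or the coefficient of index n/2 < n, so divisibility
    spreads from the constant term. Taking d = 0 proves that a series vanishes. *)
Lemma V2_descent (d : int) (c : int) (a b : fps) :
  a 0%N = 0 -> (forall n, a n = c * V 2 a n + d * b n) ->
  forall n, (d %| a n)%Z.
Proof.
move=> a0 aE; elim/ltn_ind => -[|n] IHn; first by rewrite a0 dvdz0.
rewrite aE rpredD ?(dvdz_mulr _ (dvdzz d)) // dvdz_mull //=.
by case: ifP => _; rewrite ?dvdz0 // IHn //; lia.
Qed.

Lemma fps_dvd (d : nat) (a : fps) :
  (forall n, (d%:Z %| a n)%Z) -> exists b, a = d%:R * b.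
Proof.
move=> da; exists (Fps (fun n => (a n %/ d%:Z)%Z)); apply: fpsP => n.
by rewrite mulr_natl fps_mulrn /= -mulr_natr natz divzK.
Qed.

Lemma phi_sq_dissect : phi ^+ 2 = V 2 phi ^+ 2 + 4%:R * X * V 4 psi ^+ 2.
Proof.
set e := phi ^+ 2 - V 2 phi ^+ 2 - 4%:R * X * V 4 psi ^+ 2.
suff e0 : e = 0.
  by apply/eqP; rewrite -subr_eq0 opprD addrA -/e e0.
have p4 : V 4 phi * V 8 psi = V 4 psi ^+ 2.
  by have := congr1 (V 4) phi_psi2; rewrite rmorphM rmorphXn /= V_V.
(* Expanding [phi] once by [phi_dissect4] turns the error into minus its own image under X -> X^2,
   which descent forces to be 0. *)
have eV : e = - V 2 e.
  rewrite /e !(rmorph_nat, rmorphXn, rmorphM, rmorphB,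
    rmorphD) /= !V_V // V_X //.
  rewrite {1}phi_dissect4 -p4; ring.
apply: fpsP => n; rewrite fps_0; apply/eqP; rewrite -dvd0z.
apply: (@V2_descent 0 (-1) e 0) => [|m]; last first.
  by rewrite mul0r addr0 mulN1r -fpsN -eV.
have := congr1 (fun a : fps => a 0%N) eV; rewrite fpsN V_0; lia.
Qed.

(** * Logarithmic derivatives modulo 4 *)

Lemma theta_exp a n : theta (a ^+ n.+1) = n.+1%:R * a ^+ n * theta a.
Proof.
elim: n => [|n IHn]; first by rewrite expr1 expr0; ring.
by rewrite exprS thetaM IHn (exprS a n) -[n.+2]add1n natrD; ring.
Qed.

Section LogDerivative.

(* Up to sign the logarithmic derivative of euler. *)
Variable l : fps.
Hypothesis theta_euler : theta euler = - (l * euler).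

Lemma theta_V_euler k :
  (0 < k)%N -> theta (V k euler) = - (k%:R * V k l * V k euler).
Proof. by move=> k0; rewrite theta_V // theta_euler rmorphN rmorphM /=; ring.
  Qed.

(** A factor [V k euler ^+ e] contributes -e k [V k l]; the cleared identity [phi_euler] is
    differentiated in place of the quotient. *)
Lemma theta_phi : theta phi = phi * (2%:R * l + 8%:R * V 4 l - 10%:R * V 2 l).
Proof.
have := congr1 theta phi_euler;
  rewrite !(theta_exp, thetaM) !theta_V_euler // theta_euler.
move=> E; apply: (@fps_mulI (euler ^+ 2 * V 4 euler ^+ 2)).
  by rewrite !(fps_M0, fps_X0) !V_0 euler_0.
apply/eqP; rewrite -subr_eq0; apply/eqP.
move/eqP: E; rewrite -subr_eq0 => /eqP E; rewrite -[RHS]E.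
transitivity (euler ^+ 2 * V 4 euler ^+ 2 * theta phi - 
 (phi * (euler ^+ 2 * V 4 euler ^+ 2)) * (2%:R * l + 8%:R * V 4 l) +
   10%:R * V 2 l * (phi * (euler ^+ 2 * V 4 euler ^+ 2))).
  ring.
rewrite [in X in _ + X]phi_euler; ring.
Qed.

Lemma theta_psi : theta psi = psi * (l - 4%:R * V 2 l).
Proof.
have := congr1 theta psi_euler;
  rewrite !(theta_exp, thetaM) !theta_V_euler // theta_euler.
move=> E; apply: (@fps_mulI euler); first by rewrite euler_0.
apply/eqP; rewrite -subr_eq0; apply/eqP.
move/eqP: E; rewrite -subr_eq0 => /eqP E; rewrite -[RHS]E.
transitivity (euler * theta psi - psi * euler * l +
  4%:R * V 2 l * (psi * euler)).
  ring.
rewrite [in X in _ + X]psi_euler; ring.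
Qed.

Lemma theta_pent :
  theta pent = pent * (l + 6%:R * V 6 l - 2%:R * V 2 l - 6%:R * V 3 l).
Proof.
have := congr1 theta pent_euler;
  rewrite !(theta_exp, thetaM) !theta_V_euler // theta_euler.
move=> E; apply: (@fps_mulI (euler * V 6 euler)).
  by rewrite !(fps_M0, fps_X0) !V_0 euler_0.
apply/eqP; rewrite -subr_eq0; apply/eqP.
move/eqP: E; rewrite -subr_eq0 => /eqP E; rewrite -[RHS]E.
transitivity (euler * V 6 euler * theta pent - (pent * (euler * V 6 euler)) * (l + 6%:R * V 6 l)
  + (2%:R * V 2 l + 6%:R * V 3 l) * (pent * (euler * V 6 euler))).
  ring.
rewrite [in X in _ + X]pent_euler; ring.
Qed.

(** Modulo 4, [theta squares] is phi (l - V 2 l) by the eta quotient and X * V 8 psi by the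
    splitting into odd and even squares. Multiplying by [phi], whose square is 1 modulo 4, isolates
    l - V 2 l. *)
Lemma log_derivative_mod4 :
  exists m, l - V 2 l = phi * X * V 8 psi + 4%:R * m.
Proof.
have E : theta squares = phi * (l + 4%:R * V 4 l - 5%:R * V 2 l).
  apply: (@fps_natI 2) => //; transitivity (theta phi).
    have t1 : theta 1 = 0 by rewrite -(expr0 X) theta_Xn mul0r.
    have t2 : theta 2%:R = 0 by rewrite -[2%:R]/(1 + 1) thetaD t1 addr0.
    by rewrite phiE thetaD thetaM t1 t2; ring.
  rewrite theta_phi; ring.
have := E; rewrite {1}squares_dissect thetaD thetaM theta_V // theta_V //.
rewrite -{1}(expr1 X) theta_Xn expr1 => E'.
exists (- (squares + squares ^+ 2) * (l - V 2 l) +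
  phi * (2%:R * X * V 8 (theta psi) +
    V 4 (theta squares)) - phi ^+ 2 * (V 4 l - V 2 l)).
transitivity (phi ^+ 2 * (l - V 2 l) - 4%:R * (squares +
  squares ^+ 2) * (l - V 2 l)).
  rewrite phiE; ring.
have -> : phi * X * V 8 psi = phi * (phi * (l + 4%:R * V 4 l - 5%:R * V 2 l)) -
   phi * (8%:R * X * V 8 (theta psi) + 4%:R * V 4 (theta squares)).
  rewrite -E'; ring.
ring.
Qed.

(** Classically the left-hand series sums the odd divisors d of n, while (phi^2 - 1)/4 sums the
    signs (-1)^((d-1)/2), and the two agree modulo 4 term by term. Here the difference is shown to
    reproduce itself under X -> X^2 modulo 4, so that descent applies without divisor sums. *)
Lemma two_squares_mod4 :
  exists u, l - 2%:R * V 2 l = squares + squares ^+ 2 + 4%:R * u.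
Proof.
have [m mE] := log_derivative_mod4.
set a := l - 2%:R * V 2 l - (squares + squares ^+ 2).
suff [u uE] : exists u, a = 4%:R * u.
  by exists u; rewrite -uE /a; ring.
apply: fps_dvd => n.
have sqE : squares + squares ^+ 2 = V 2 (squares + squares ^+ 2) +
  X * V 4 psi ^+ 2.
  apply: (@fps_natI 4) => //; have := phi_sq_dissect.
  rewrite phiE !(rmorph_nat, rmorph1, rmorphXn, rmorphM, rmorphD) /=.
  move/(congr1 (fun c => c - 1)) => E.
  transitivity ((1 + 2%:R * squares) ^+ 2 - 1); first by ring.
  by rewrite E; ring.
have p4 : V 4 phi * V 8 psi = V 4 psi ^+ 2.
  by have := congr1 (V 4) phi_psi2; rewrite rmorphM rmorphXn /= V_V.
have m2 : V 2 l - V 4 l = V 2 phi * X ^+ 2 * V 16 psi + 4%:R * V 2 m.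
  have := congr1 (V 2) mE.
  by rewrite !(rmorph_nat, rmorphXn, rmorphM, rmorphB, rmorphD) /= !V_V // V_X.
have phi2 : V 2 phi = V 8 phi + 2%:R * X ^+ 2 * V 16 psi.
  by rewrite {1}phi_dissect4 !(rmorph_nat, rmorphM, rmorphD) /= !V_V // V_X.
have p8 : V 8 phi * V 16 psi = V 8 psi ^+ 2.
  by have := congr1 (V 8) phi_psi2; rewrite rmorphM rmorphXn /= V_V.
(* The terms of a - V 2 a that are not visibly multiples of 4 cancel through [p4] and [p8]. *)
have aE : a = V 2 a + 4%:R * (m - 2%:R * V 2 m - X ^+ 4 * V 16 psi ^+ 2).
  transitivity (V 2 a + (l - V 2 l - 2%:R * (V 2 l - V 4 l) - X * V 4 psi ^+ 2)).
    rewrite /a {1}sqE !(rmorph_nat, rmorphM, rmorphB) /= V_V //; ring.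
  rewrite mE m2 -p4 phi2 {1}phi_dissect4.
  transitivity (V 2 a + (2%:R * X ^+ 2 * (V 8 psi ^+ 2 - V 8 phi * V 16 psi)
    + 4%:R * (m - 2%:R * V 2 m - X ^+ 4 * V 16 psi ^+ 2))); first by ring.
  rewrite p8; ring.
apply: (@V2_descent 4 1 a (m - 2%:R * V 2 m - X ^+ 4 * V 16 psi ^+ 2)) => [|k].
  have l0 : l 0%N = 0.
    have := congr1 (fun c : fps => c 0%N) theta_euler.
    by rewrite coef_theta mulr0n fpsN fps_M0 euler_0; lia.
  rewrite /a !fpsB fpsD fps_X0 squares_0 l0 fps_M0 V_0 l0; lia.
rewrite {1}aE fpsD mul1r mulr_natl fps_mulrn; congr (_ + _).
by rewrite -[LHS]mulr_natl natz.
Qed.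

Lemma theta_main : exists u,
  theta (pent * V 6 psi) =
  pent * V 6 psi * (l - 2%:R * V 2 l + 2%:R * V 3 l + 4%:R * u).
Proof.
(* The exact logarithmic derivative is l - 2 V 2 l - 6 V 3 l + 12 V 6 l - 24 V 12 l; modulo 4 the -6
   becomes the 2 that phi(q^3)^4 will produce. *)
exists (3%:R * V 6 l - 2%:R * V 3 l - 6%:R * V 12 l).
rewrite thetaM theta_V // theta_pent theta_psi.
rewrite !(rmorph_nat, rmorphM, rmorphB) /= V_V //; ring.
Qed.

End LogDerivative.

Lemma phi8_mod16 : exists u, phi ^+ 8 = 1 + 16%:R * u.
Proof.
pose s := squares + squares ^+ 2.
have E : phi ^+ 2 = 1 + 4%:R * s by rewrite phiE /s; ring.
exists (s + 6%:R * s ^+ 2 + 16%:R * s ^+ 3 + 16%:R * s ^+ 4).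
transitivity ((phi ^+ 2) ^+ 4); first by ring.
rewrite E; ring.
Qed.

Lemma twist_mod16 : exists u, let F := pent * V 6 psi in
  F * (phi ^+ 2 * V 3 phi ^+ 4) = F + 4%:R * theta F + 16%:R * u.
Proof.
have [v ev] := fps_inv euler_0; pose l := - (theta euler * v).
have lE : theta euler = - (l * euler).
  transitivity (theta euler * (euler * v)); first by rewrite ev mulr1.
  rewrite /l; ring.
have [u1 E1] := two_squares_mod4 lE; have [u2 E2] := theta_main lE.
pose s := squares + squares ^+ 2; pose T := l - 2%:R * V 2 l.
have phi2 : phi ^+ 2 = 1 + 4%:R * (T - 4%:R * u1).
  by rewrite phiE /T E1; ring.
have a2 : V 3 phi ^+ 2 = 1 + 4%:R * (V 3 l - 2%:R * V 6 l - 4%:R * V 3 u1).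
  rewrite -rmorphXn /= phi2 /T.
  by rewrite !(rmorph_nat, rmorph1, rmorphM, rmorphB, rmorphD) /= V_V.
pose b := V 3 l - 2%:R * V 6 l - 4%:R * V 3 u1.
(* Modulo 16, (1 + 4 T) (1 + 4 V 3 T)^2 is 1 + 4 (T + 2 V 3 T), and T + 2 V 3 T is the logarithmic
   derivative of F modulo 4. The witness is the exact remainder. *)
exists (pent * V 6 psi * ((1 +
  4%:R * (T - 4%:R * u1)) * (b ^+ 2 - V 6 l - 2%:R * V 3 u1) +
  2%:R * (T - 4%:R * u1) * V 3 l - u1 - u2)).
rewrite /= E2.
transitivity (pent * V 6 psi * (phi ^+ 2 * (V 3 phi ^+ 2) ^+ 2)); first by ring.
rewrite a2 phi2 /b /T; ring.
Qed.

Lemma ped_series_mod192 (A : fps) : A * phi = psi ->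
  exists w, let F := pent * V 6 psi in
  sect 3 2 (sect 3 1 A) = - (12%:R * (F + 4%:R * theta F)) + 192%:R * w.
Proof.
move=> Aphi; have := sect12_quotient Aphi.
have [u uE] := phi8_mod16; have [y yE] := twist_mod16.
rewrite uE yE /=; set B := sect 3 2 _; set F := pent * _; set G := F + _ => BE.
have [|v vE] := @fps_inv (1 + 16%:R * u).
  by rewrite -uE fps_X0 phi_0 expr1n.
exists (- (y * v) + u * v * G).
(* The inverse of phi^8 is 1 modulo 16 too, so multiplying by it changes a multiple of 12 by a
   multiple of 192. *)
have v1 : v = 1 - 16%:R * u * v.
  by transitivity ((1 + 16%:R * u) * v - 16%:R * u * v); [ring | rewrite vE].
have -> : B = B * (1 + 16%:R * u) * v by rewrite -mulrA vE mulr1.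
rewrite BE.
transitivity (- (12%:R * G * v) - 192%:R * (y * v)); first by ring.
rewrite {1}v1; ring.
Qed.

(** * Exponents occurring in F, and the prime 5 *)

Lemma pent_neq0 n : pent n != 0 -> exists x, (24 * n + 1 = x ^ 2)%N.
Proof.
have tE r s m := mul2_texp r s m.
have H (i j : int) : i + j != 0 -> i != 0 \/ j != 0.
  by case: (eqVneq i 0) => [->|]; [rewrite add0r; right | left].
rewrite pent.unlock fpsD => /H[] /coef_psum_neq0[m <-].
  exists (6 * m + 1)%N; have := tE 2%N 1%N m; case: m => [|m]; nia.
exists (6 * m + 5)%N; have := tE 1%N 2%N m.+1; nia.
Qed.

Lemma psi_neq0 n : psi n != 0 -> exists v, (8 * n + 1 = v ^ 2)%N.
Proof.
by move=> /coef_psum_neq0[m <-]; exists (2 * m + 1)%N; have := mul2_bin2 m; nia.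
Qed.

Lemma sq_mod5 x v : (5 %| x ^ 2 + 18 * v ^ 2)%N -> (25 %| x ^ 2 + 18 * v ^ 2)%N.
Proof.
move=> H; have: (5 %| x)%N && (5 %| v)%N; last first.
  by case/andP => /dvdnP[a ->] /dvdnP[b ->]; apply/dvdnP;
    exists (a ^ 2 + 18 * b ^ 2)%N; nia.
move: H; rewrite {1}(divn_eq x 5) {1}(divn_eq v 5) /dvdn.
have := ltn_pmod x (isT : (0 < 5)%N); have := ltn_pmod v (isT : (0 < 5)%N).
move: (x %% 5)%N (v %% 5)%N (x %/ 5)%N (v %/ 5)%N => r s a b.
case: r => [|[|[|[|[|]]]]] //; case: s => [|[|[|[|[|]]]]] // _ _; lia.
Qed.

Lemma pent_psi_eq0 n : (5 %| 24 * n + 19)%N -> ~~ (25 %| 24 * n + 19)%N ->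
  (pent * V 6 psi) n = 0.
Proof.
move=> d5 nd25; rewrite fps_sumM big1 // => i _; have lti := ltn_ord i.
case: (eqVneq (pent i) 0) => [->|/pent_neq0[x xE]]; first by rewrite mul0r.
have [/dvdnP[j jE]|nd] := boolP (6 %| n - i)%N; last first.
  by rewrite [V 6 psi _]ifN // mulr0.
rewrite jE mulnC coef_V //; case: (eqVneq (psi j) 0) => [->|/psi_neq0[v vE]].
  by rewrite mulr0.
(* With n = i + 6 j the left-hand side is (24 i + 1) + 18 (8 j + 1). *)
have E : (24 * n + 19 = x ^ 2 + 18 * v ^ 2)%N by lia.
by move: nd25; rewrite E sq_mod5 // -E.
Qed.

(** * Partitions with distinct even parts *)

Definition geom (k : nat) : fps := Fps (fun n => (k %| n)%:R).

Lemma geomM k : (0 < k)%N -> (1 - X ^+ k) * geom k = 1.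
Proof.
move=> k0; apply: fpsP => n; rewrite mulrBl mul1r fpsB coef_XnM fps_1 /=.
case: ltnP => [ltnk|lekn].
  by rewrite subr0 /dvdn modn_small.
rewrite -{1}(subnK lekn) dvdn_addl // subrr.
by case: n lekn => //; lia.
Qed.

Definition ped_factor (i : nat) : fps :=
  if odd i.+1 then geom i.+1 else 1 + X ^+ i.+1.

Definition bounded_ped (M n : nat) (s : seq nat) : bool :=
  is_ped_partition n s && all (leq^~ M) s.

(** The bound on the tail encodes distinctness: an odd part x may be followed by x again, an even
    one only by smaller parts. *)
Lemma bounded_ped_cons M n x s :
  bounded_ped M n (x :: s) =
  [&& (0 < x)%N, (x <= M)%N, (x <= n)%N &
      bounded_ped (if odd x then x else x.-1) (n - x) s].
Proof.
rewrite /bounded_ped /is_ped_partition /is_partition /= path_sortedE;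
  last first.
  by move=> a b c; rewrite /geq /= => ? ?; lia.
rewrite inE negb_or eq_sym -lt0n.
apply/idP/idP.
  case/andP => /andP[/and3P[/andP[lex ss] /andP[x0 s0] /eqP sn] us] /andP[xM sM].
  rewrite x0 xM ss s0 /=; have -> : (x <= n)%N by lia.
  have -> : (sumn s == n - x)%N by apply/eqP; lia.
  move: us; have [ox|ex] := boolP (odd x); first by move=> ->.
  rewrite /= mem_filter ex => /andP[nx ->]; apply/allP => y ys.
  have leyx : (y <= x)%N by move/allP: lex => /(_ y ys).
  by have [yx|] := eqVneq y x; [move: nx; rewrite -yx ys | lia].
case/and4P => x0 xM xn /andP[/andP[/and3P[ss s0 /eqP sn] us] sx].
have lex : all (geq x) s.
  by apply: sub_all sx => y /=; case: ifP => _ ?; rewrite /geq /=; lia.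
rewrite lex ss x0 s0 xM /=; have -> : (x + sumn s == n)%N by apply/eqP; lia.
rewrite (sub_all _ lex) => [|y /= leyx]; last exact: leq_trans leyx xM.
rewrite andbT; move: sx; have [ox|ex] := boolP (odd x) => //= sx.
rewrite us mem_filter ex andbT /=; apply/negP => xs.
by move/allP: sx => /(_ x xs); lia.
Qed.

Lemma bounded_ped_nil M n : bounded_ped M n [::] = (n == 0%N).
Proof. by rewrite /bounded_ped /is_ped_partition /is_partition /= !andbT eq_sym. Qed.

Lemma bounded_pedS M n s : bounded_ped M.+1 n s =
  bounded_ped M n s || [&& (M < n)%N, ohead s == Some M.+1 &
    bounded_ped (if odd M.+1 then M.+1 else M) (n - M.+1) (behead s)].
Proof.
case: s => [|x s]; first by rewrite !bounded_ped_nil /= andbF orbF.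
rewrite !bounded_ped_cons /=; have [->|neq] := eqVneq x M.+1.
  by rewrite eqxx ltnn leqnn /=.
have -> : (Some x == Some M.+1) = false by apply/eqP => -[] /eqP; apply/negP.
by rewrite !andbF orbF (leq_eqVlt x) (negPf neq).
Qed.

(** A partition either avoids the part M+1 or starts with it, and the partial products obey the same
    recursion. When M+1 is odd the tail keeps the bound M+1, hence the inner induction on n. *)
Lemma bounded_ped_enum M n : exists l : seq (seq nat),
  [/\ uniq l, forall s, (s \in l) = bounded_ped M n s &
      (size l)%:Z = (\prod_(i < M) ped_factor i) n].
Proof.
pose C M := \prod_(i < M) ped_factor i; rewrite -/(C M).
(* For odd m+1 this is the geometric factor unrolled once, C (m+1) = C m + X^(m+1) C (m+1); for even
   m+1 it just expands 1 + X^(m+1). *)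
have CS m k : C m.+1 k = C m k +
    if (k < m.+1)%N then 0 else C (if odd m.+1 then m.+1 else m) (k - m.+1)%N.
  have E : C m.+1 = C m + X ^+ m.+1 * C (if odd m.+1 then m.+1 else m).
    have PS : C m.+1 = C m * ped_factor m by exact: big_ord_recr.
    rewrite {1}PS /ped_factor; case: ifP => oddm; last by ring.
    rewrite PS /ped_factor oddm.
    transitivity (C m * ((1 - X ^+ m.+1) * geom m.+1 + X ^+ m.+1 * geom m.+1)).
      by ring.
    by rewrite geomM //; ring.
  by rewrite {1}E fpsD coef_XnM.
elim: M n => [|M IHM] n.
  exists (if n == 0%N then [:: [::]] else [::]); split.
  - by case: ifP.
  - move=> [|x s]; first by rewrite bounded_ped_nil; case: ifP.
    by rewrite bounded_ped_cons; case: ifP; case: x.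
  - by rewrite /C big_ord0 fps_1; case: ifP.
elim/ltn_ind: n => n IHn; have [l [ul lE lS]] := IHM n.
have [l' [ul' lE' lS']] : exists l' : seq (seq nat),
    [/\ uniq l', forall s, (s \in l') = (M < n)%N &&
      bounded_ped (if odd M.+1 then M.+1 else M) (n - M.+1) s &
      (size l')%:Z = if (n < M.+1)%N then 0 else
        C (if odd M.+1 then M.+1 else M) (n - M.+1)%N].
  have [leMn|ltnM] := leqP M.+1 n; last by exists [::].
  have ltn : (n - M.+1 < n)%N by lia.
  by case: (odd M.+1); [exact: IHn | exact: IHM].
exists (l ++ [seq M.+1 :: s | s <- l']); split.
- rewrite cat_uniq ul map_inj_uniq ?ul' ?andbT => [|s t []//].
  apply/hasPn => s /mapP[t _ ->]; rewrite lE bounded_ped_cons.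
  by rewrite ltnn andbF.
- move=> s; rewrite mem_cat lE bounded_pedS; congr (_ || _).
  apply/mapP/and3P => [[t + ->]|[ltMn]].
    by rewrite lE' /= => /andP[-> ->]; rewrite eqxx.
  case: s => [|x s] //= /eqP[->] bs; exists s => //.
  by rewrite lE' ltMn.
- by rewrite CS size_cat size_map PoszD lS lS'.
Qed.

Lemma card_ped_partitions n (l : seq (seq nat)) :
  uniq l -> (forall s, (s \in l) = is_ped_partition n s) -> ped n = size l.
Proof.
move=> ul meml; rewrite /ped cardE.
set A := [set _ | _]; pose f (s : n.-bseq 'I_n.+1) := [seq val i | i <- s].
rewrite -(size_map f); apply: perm_size; apply: uniq_perm => //.
  rewrite map_inj_uniq ?enum_uniq // => s t /(inj_map val_inj) st.
  exact: val_inj.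
move=> s; rewrite meml; apply/mapP/idP => [[t + ->]|peds].
  by rewrite mem_enum inE.
have /andP[sz bd] : (size s <= n)%N && all (leq^~ n) s.
  by apply: is_partition_bounds; case/andP: peds.
have szs : (size [seq inord x : 'I_n.+1 | x <- s] <= n)%N by rewrite size_map.
have fs : f (Bseq szs) = s.
  rewrite /f /= -map_comp; apply: map_id_in => x /(allP bd) /= lex.
  by rewrite inordK.
by exists (Bseq szs) => //; rewrite mem_enum inE -/(f _) fs.
Qed.

Definition ped_series : fps := Fps (fun n => (ped n)%:Z).

Lemma eqmod_geom k : eqmod k (geom k) 1.
Proof.
move=> n ltnk; rewrite fps_1 /=; case: n ltnk => [|n] ltnk;
  first by rewrite dvdn0.
by rewrite gtnNdvd.
Qed.

Lemma eqmod_ped_factor j : eqmod j.+1 (ped_factor j) 1.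
Proof.
by rewrite /ped_factor; case: ifP => _; [apply: eqmod_geom | apply: eqmod_1pXn].
Qed.

Lemma ped_series_prod : ped_series = iprod ped_factor.
Proof.
(* The bound n+1 matches the n+1 factors that [iprod] reads at n; parts of a partition of n are at
   most n anyway. *)
apply: fpsP => n; have [l [ul lE lS]] := bounded_ped_enum n.+1 n.
rewrite -[RHS]lS /= (card_ped_partitions ul) // => s; rewrite lE /bounded_ped.
apply: andb_idr => /andP[/is_partition_bounds/andP[_ /allP le_n] _].
by apply/allP => x /le_n /leqW.
Qed.

Lemma ped_series_euler_plus :
  ped_series * iprod (fun j => 1 - X ^+ (2 * j).+1) = V 2 euler_plus.
Proof.
rewrite ped_series_prod (@iprod_group 2) //; last exact: eqmod_ped_factor.
rewrite iprodM => [|j|j]; last by apply: eqmod_1mXn; lia.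
  rewrite V_euler_plus //; apply: eq_iprod => j.
  rewrite !big_ord_recl big_ord0 mulr1 /= /bump /= /ped_factor.
  rewrite ifT; last by lia.
  rewrite ifF; last by lia.
  have -> : (j * 2 + 0).+1 = (2 * j).+1 by lia.
  have -> : (j * 2 + (1 + 0)).+1 = (2 * j.+1)%N by lia.
  by rewrite mulrAC [geom _ * _]mulrC geomM // mul1r.
apply: eqmod_prod1 => i _; apply: eqmod_le (@eqmod_ped_factor _); lia.
Qed.

(** The sign change turns the factors 1 - X^(2j+1) into those of [euler_odd] and fixes the even
    ones. One of the two [euler_odd] in [phi] then cancels, leaving the product for [psi]. *)
Lemma alt_ped_series : alt ped_series * phi = psi.
Proof.
have e4 : V 4 euler = V 2 euler_plus * V 2 euler.
  by rewrite -rmorphM /= euler_plusM V_V.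
have := congr1 alt ped_series_euler_plus; rewrite rmorphM /=.
rewrite [alt (iprod _)]alt_iprod; last by eqmod1.
rewrite (@eq_iprod _ (fun j => 1 + X ^+ (2 * j).+1)); last first.
  move=> j; rewrite rmorphB rmorph1 rmorphXn /= alt_X exprNn.
  have -> : (-1) ^+ (2 * j).+1 = -1 :> fps.
    by rewrite exprS exprM sqrrN !expr1n mulr1.
  by rewrite mulN1r opprK.
rewrite -/euler_odd V_euler_plus // alt_iprod; last by eqmod1.
rewrite (@eq_iprod _ (fun j => 1 + X ^+ (2 * j.+1))); last first.
  move=> j; rewrite rmorphD rmorph1 rmorphXn /= alt_X exprNn.
  by rewrite [(-1) ^+ _]exprM sqrrN !expr1n mul1r.
rewrite -V_euler_plus // => E.
rewrite phi_prod psi_prod e4 -E; ring.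
Qed.

Lemma ped_dvd192 m : (5 %| 24 * m + 19)%N -> ~~ (25 %| 24 * m + 19)%N ->
  ped (9 * m + 7) = 0 %[mod 192].
Proof.
move=> d5 nd25; have F0 := pent_psi_eq0 d5 nd25.
have [w wE] := ped_series_mod192 alt_ped_series.
have := congr1 (fun a : fps => a m) wE.
rewrite !coef_sect fpsD fpsN !mulr_natl !fps_mulrn fpsD fps_mulrn coef_theta F0.
rewrite !(mul0rn, addr0, add0r, oppr0) coef_alt.
have -> : (3 * (3 * m + 2) + 1 = 9 * m + 7)%N by lia.
rewrite -signr_odd -[ped_series _]/((ped (9 * m + 7))%:Z).
set p := ped _; set b := odd _ => E.
apply/eqP; rewrite mod0n -/(dvdn 192 p).
have : (192 %| p%:Z)%Z.
  (* The power of -1 undoes the sign introduced by [alt]. *)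
  apply/dvdzP; exists ((-1) ^+ b * w m).
  by move: E; case: b; rewrite ?expr1 ?expr0 ?mul1r ?mulN1r -mulr_natr; lia.
by rewrite /dvdz.
Qed.

Local Close Scope ring_scope.

Theorem theorem1p2 (n : nat) :
  [/\ ped (225 * n + 43) = 0 %[mod 192],
      ped (225 * n + 88) = 0 %[mod 192],
      ped (225 * n + 133) = 0 %[mod 192] &
      ped (225 * n + 223) = 0 %[mod 192]].
Proof.
have E r : (225 * n + (9 * r + 7) = 9 * (25 * n + r) + 7)%N by lia.
(* 5 divides 24 r + 19 exactly when r is 4 modulo 5. Among r < 25 only r = 19 is lost, since 24 * 19
   + 19 = 19 * 25; it corresponds to the absent class 178 modulo 225. *)
split; [rewrite (E 4) | rewrite (E 9) | rewrite (E 14) | rewrite (E 24)];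
  apply: ped_dvd192; lia.
Qed.
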